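(* Let $p\in[1,\infty)$ and let $(p_k)_{k=1}^\infty$ be any sequence in $[1,\infty)$ that diverges to $\infty$. Then the Banach space $$X_p=\left(\bigoplus_{k=1}^\infty \ell_{p_k}(\omega_k)\right)_{\ell_p}$$ satisfies $\gamma(X_p)=2$. In particular, $X_1$ is an octahedral Banach space with $\gamma(X_1)=2$; further, if $p>1$ and each $p_k\in(1,\infty)$, then $X_p$ is a reflexive Banach space with $\gamma(X_p)=2$.
   Context: Spaces are real. $\omega_k$ denotes the cardinal $\aleph_k$, and $\ell_q(\omega_k)$ is the $\ell_q$ space over an index set of cardinality $\aleph_k$. $(\bigoplus_k X_k)_{\ell_p}$ is the $\ell_p$-sum, i.e. all sequences $(x_k)$, $x_k\in X_k$, with $\|(x_k)\|=(\sum_k\|x_k\|^p)^{1/p}<\infty$. A set $P\subseteq X$ is $r$-separated if $\|x-y\|\ge r$ for all distinct $x,y\in P$, and $r$-dense if for every $x\in X$ there is $q\in P$ with $\|x-q\|\le r$. $\gamma(X)=\inf\{r>0:\text{there exists an }r\text{-dense and }2\text{-separated set }P\subseteq X\}$. $X$ is octahedral if for every finite-dimensional subspace $Z$ of $X$ and every $\varepsilon>0$ there is $x\in X$ with $\|x\|=1$ and $\|z+\lambda x\|\ge(1-\varepsilon)(\|z\|+|\lambda|)$ for all $z\in Z$, $\lambda\in\mathbb{R}$. *)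

(* Defs.v *)
From HB Require Import structures.
From mathcomp Require Import all_boot all_order all_algebra finmap.
From mathcomp Require Import all_classical all_reals all_analysis.

Set Implicit Arguments.
Unset Strict Implicit.
Unset Printing Implicit Defensive.

Import Order.TTheory GRing.Theory Num.Theory.
Import numFieldNormedType.Exports.

Local Open Scope classical_set_scope.
Local Open Scope card_scope.
Local Open Scope ring_scope.

(* [has_aleph k A]: the set A has cardinality aleph_k. The cardinal of A is the
   successor of the cardinal of B when B < A and no cardinal lies strictly in
   between; every cardinal below that of A is the cardinal of a subset of A. *)
Fixpoint has_aleph (k : nat) (T : Type) (A : set T) : Prop :=
  if k is k'.+1 then
    exists B : set T, [/\ B `<=` A, has_aleph k' B, ~ (A #<= B) &
      forall C : set T, C `<=` A -> C #<= B \/ C #= A]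
  else A #= [set: nat].

Lemma powR_le (R : realType) (r x y : R) :
  0 < r -> 0 <= x -> x <= y -> x `^ r <= y `^ r.
Proof.
move=> r0 x0 xy; apply: ge0_ler_powR => //; rewrite ?nnegrE ?(ltW r0)//.
exact: le_trans xy.
Qed.

Section FiniteMinkowski.
Context (R : realType) (p : R) (p1 : 1 <= p).

Let p0 : 0 < p. Proof. exact: lt_le_trans p1. Qed.

Lemma powR_add_convex (A B a b : R) : 0 < A -> 0 < B -> 0 <= a -> 0 <= b ->
  (a + b) `^ p <=
  (A + B) `^ p * (A / (A + B) * (a `^ p / A `^ p)
                  + B / (A + B) * (b `^ p / B `^ p)).
Proof.
move=> A0 B0 a0 b0; have AB0 : 0 < A + B by rewrite addr_gt0.
have t01 : 0 <= A / (A + B) <= 1.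
  by apply/andP; split; [rewrite divr_ge0 ?ltW|rewrite ler_pdivrMr ?mul1r ?lerDl ?ltW].
have /andP[t0 t1] := t01.
have := @convex_powR R p p1 (Itv01 t0 t1) (a / A) (b / B).
rewrite !inE/= !in_itv/= !andbT => /(_ (divr_ge0 a0 (ltW A0)) (divr_ge0 b0 (ltW B0))).
rewrite convRE [X in X `^ _ <= _ -> _]convRE/= /unstable.onem.
have -> : 1 - A / (A + B) = B / (A + B).
  by rewrite -{1}(divff (lt0r_neq0 AB0)) -mulrBl addrC addKr.
have powRdiv (x y : R) : 0 <= x -> 0 < y -> (x / y) `^ p = x `^ p / y `^ p.
  move=> x0 y0; rewrite powRM// ?invr_ge0 1?ltW//; congr (_ * _).
  by rewrite -powR_inv1 1?ltW// -powRrM mulN1r powRN.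
have -> : A / (A + B) * (a / A) + B / (A + B) * (b / B) = (a + b) / (A + B).
  have cancel x y s : 0 < x -> x / s * (y / x) = y / s :> R.
    by move=> x0; rewrite mulrC mulrA divfK ?gt_eqF.
  by rewrite !cancel// -mulrDl.
rewrite !powRdiv ?addr_ge0// ler_pdivrMr ?powR_gt0// => h.
by rewrite mulrC.
Qed.

Lemma minkowski_fin (I : Type) (s : seq I) (a b : I -> R) (A B : R) :
  0 < A -> 0 < B -> (forall i, 0 <= a i) -> (forall i, 0 <= b i) ->
  \sum_(i <- s) a i `^ p <= A `^ p -> \sum_(i <- s) b i `^ p <= B `^ p ->
  \sum_(i <- s) (a i + b i) `^ p <= (A + B) `^ p.
Proof.
move=> A0 B0 a0 b0 hA hB; have AB0 : 0 < A + B by rewrite addr_gt0.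
apply: (le_trans (ler_sum _ (fun i _ => powR_add_convex A0 B0 (a0 i) (b0 i)))).
rewrite -mulr_sumr -[leRHS]mulr1 ler_wpM2l ?powR_ge0//.
rewrite big_split/= -!mulr_sumr -!mulr_suml.
rewrite -[leRHS](divff (lt0r_neq0 AB0)) [leRHS]mulrDl.
by apply: lerD; (apply: ler_piMr;
  [rewrite divr_ge0 ?ltW|rewrite ler_pdivrMr ?powR_gt0// mul1r]).
Qed.

End FiniteMinkowski.

(* The proof p1 is a parameter of the type, so that the Banach space structure,
   which needs 1 <= p, can be inferred from the type alone. *)
Record lpsum (R : realType) (p : R) (p1 : 1 <= p) (I : choiceType)
    (X : I -> completeNormedModType R) := LpSum {
  lpfun :> forall i, X i ;
  lpfunP : (\esum_(i in [set: I]) (`|lpfun i| `^ p)%:E < +oo)%E }.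

Section LpSum.
Context (R : realType) (p : R) (p1 : 1 <= p) (I : choiceType).
Context (X : I -> completeNormedModType R).

Let p0 : 0 < p. Proof. exact: lt_le_trans p1. Qed.

Definition lpenergy (x : forall i, X i) : \bar R :=
  (\esum_(i in [set: I]) (`|x i| `^ p)%:E)%E.

Definition lpnorm (x : forall i, X i) : R := fine (lpenergy x) `^ p^-1.

Lemma lpenergy_leP (x : forall i, X i) (r : R) :
  (lpenergy x <= r%:E)%E <->
  forall F : {fset I}, \sum_(i <- F) `|x i| `^ p <= r.
Proof.
split=> [h F|h].
  rewrite -lee_fin; apply: le_trans h; rewrite -sumEFin.
  apply: esum_ge; exists [set` F]; first by split => //.
  by rewrite fsbig_finite//= set_fsetK.
apply: ge_ereal_sup => _ [A [finA _] <-].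
by rewrite fsbig_finite//= sumEFin lee_fin.
Qed.

Lemma lpenergy_ge0 (x : forall i, X i) : (0 <= lpenergy x)%E.
Proof. by apply: esum_ge0 => i _; rewrite lee_fin powR_ge0. Qed.

Lemma lpnorm_ge0 (x : forall i, X i) : 0 <= lpnorm x.
Proof. exact: powR_ge0. Qed.

Lemma lpnorm_leP (x : lpsum p1 X) (r : R) : 0 <= r ->
  lpnorm x <= r <-> forall F : {fset I}, \sum_(i <- F) `|x i| `^ p <= r `^ p.
Proof.
move=> r0; rewrite -lpenergy_leP.
have Efin : lpenergy x \is a fin_num.
  by rewrite ge0_fin_numE ?lpenergy_ge0//; exact: lpfunP.
have e0 : 0 <= fine (lpenergy x) by rewrite fine_ge0 ?lpenergy_ge0.
rewrite -(fineK Efin) lee_fin /lpnorm.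
have pn0 : p != 0 by rewrite gt_eqF.
split=> h.
  rewrite -[leLHS]powRr1// -(mulVf pn0) powRrM.
  by apply: powR_le; rewrite ?powR_ge0.
rewrite -[leRHS]powRr1// -(mulfV pn0) (powRrM r).
by apply: powR_le; rewrite ?invr_gt0.
Qed.

Lemma lpfin (x : forall i, X i) (r : R) :
  (forall F : {fset I}, \sum_(i <- F) `|x i| `^ p <= r) ->
  (lpenergy x < +oo)%E.
Proof. by move=> /lpenergy_leP/le_lt_trans; apply; rewrite ltry. Qed.

Lemma lpsum_eq (x y : lpsum p1 X) : (forall i, x i = y i) -> x = y.
Proof.
case: x y => [x xP] [y yP] /= xy.
have {}xy : x = y by apply: functional_extensionality_dep.
by subst y; congr LpSum; exact: Prop_irrelevance.
Qed.

Lemma lpnormS (x : lpsum p1 X) (e : R) (F : {fset I}) : 0 < e ->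
  \sum_(i <- F) `|x i| `^ p <= (lpnorm x + e) `^ p.
Proof.
move=> e0; have := lpnorm_leP x (addr_ge0 (lpnorm_ge0 x) (ltW e0)).
by case=> + _; apply; rewrite lerDl ltW.
Qed.

Lemma lpadd_sum_le (x y : lpsum p1 X) (e : R) (F : {fset I}) : 0 < e ->
  \sum_(i <- F) `|x i + y i| `^ p <= (lpnorm x + e + (lpnorm y + e)) `^ p.
Proof.
move=> e0; apply: (@le_trans _ _ (\sum_(i <- F) (`|x i| + `|y i|) `^ p)).
  apply: ler_sum => i _; apply: powR_le; rewrite //.
  exact: ler_normD.
by apply: minkowski_fin => //; rewrite ?ltr_wpDl ?lpnorm_ge0//; exact: lpnormS.
Qed.

Lemma lpzero_fin : (lpenergy (fun i => 0%R) < +oo)%E.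
Proof.
apply: (@lpfin _ 0) => F; rewrite big1// => i _.
by rewrite normr0 powR0// gt_eqF.
Qed.

Lemma lpadd_fin (x y : lpsum p1 X) : (lpenergy (fun i => x i + y i)%R < +oo)%E.
Proof. by apply: lpfin => F; exact: (lpadd_sum_le _ _ _ ltr01). Qed.

Lemma lpscale_sum (c : R) (x : lpsum p1 X) (F : {fset I}) :
  \sum_(i <- F) `|c *: x i| `^ p = `|c| `^ p * \sum_(i <- F) `|x i| `^ p.
Proof. by rewrite mulr_sumr; apply: eq_bigr => i _; rewrite normrZ powRM. Qed.

Lemma lpscale_fin (c : R) (x : lpsum p1 X) :
  (lpenergy (fun i => c *: x i)%R < +oo)%E.
Proof.
apply: (@lpfin _ (`|c| `^ p * (lpnorm x + 1) `^ p)) => F.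
by rewrite lpscale_sum ler_wpM2l ?powR_ge0// lpnormS.
Qed.

Lemma lpopp_fin (x : lpsum p1 X) : (lpenergy (fun i => - x i)%R < +oo)%E.
Proof.
apply: (@lpfin _ ((lpnorm x + 1) `^ p)) => F.
by under eq_bigr do rewrite normrN; exact: lpnormS.
Qed.

Definition lpzero : lpsum p1 X := LpSum p1 lpzero_fin.
Definition lpopp (x : lpsum p1 X) : lpsum p1 X := LpSum p1 (lpopp_fin x).
Definition lpadd (x y : lpsum p1 X) : lpsum p1 X := LpSum p1 (lpadd_fin x y).
Definition lpscale (c : R) (x : lpsum p1 X) : lpsum p1 X :=
  LpSum p1 (lpscale_fin c x).

HB.instance Definition _ := gen_eqMixin (lpsum p1 X).
HB.instance Definition _ := gen_choiceMixin (lpsum p1 X).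

Lemma lpaddA : associative lpadd.
Proof. by move=> x y z; apply: lpsum_eq => i /=; rewrite addrA. Qed.

Lemma lpaddC : commutative lpadd.
Proof. by move=> x y; apply: lpsum_eq => i /=; rewrite addrC. Qed.

Lemma lpadd0 : left_id lpzero lpadd.
Proof. by move=> x; apply: lpsum_eq => i /=; rewrite add0r. Qed.

Lemma lpaddN : left_inverse lpzero lpopp lpadd.
Proof. by move=> x; apply: lpsum_eq => i /=; rewrite addNr. Qed.

HB.instance Definition _ :=
  GRing.isZmodule.Build (lpsum p1 X) lpaddA lpaddC lpadd0 lpaddN.

Lemma lpscaleA (a b : R) (x : lpsum p1 X) :
  lpscale a (lpscale b x) = lpscale (a * b) x.
Proof. by apply: lpsum_eq => i /=; rewrite scalerA. Qed.

Lemma lpscale1 : left_id 1 lpscale.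
Proof. by move=> x; apply: lpsum_eq => i /=; rewrite scale1r. Qed.

Lemma lpscaleDr : right_distributive lpscale +%R.
Proof. by move=> a x y; apply: lpsum_eq => i /=; rewrite scalerDr. Qed.

Lemma lpscaleDl (x : lpsum p1 X) :
  {morph lpscale^~ x : a b / a + b}.
Proof. by move=> a b; apply: lpsum_eq => i /=; rewrite scalerDl. Qed.

HB.instance Definition _ := GRing.Zmodule_isLmodule.Build R (lpsum p1 X)
  lpscaleA lpscale1 lpscaleDr lpscaleDl.

Lemma lpnormD (x y : lpsum p1 X) : lpnorm (x + y) <= lpnorm x + lpnorm y.
Proof.
apply/ler_addgt0Pr => e e0.
have e2 : 0 < e / 2 by rewrite divr_gt0.
apply/lpnorm_leP; first by rewrite !addr_ge0 ?lpnorm_ge0// ltW.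
move=> F; rewrite [in leRHS](splitr e) addrACA.
exact: lpadd_sum_le.
Qed.

Lemma lpnormZ_le (c : R) (x : lpsum p1 X) :
  lpnorm (c *: x) <= `|c| * lpnorm x.
Proof.
apply/lpnorm_leP; first by rewrite mulr_ge0 ?lpnorm_ge0.
move=> F; rewrite powRM ?lpnorm_ge0// lpscale_sum ler_wpM2l ?powR_ge0//.
by have [+ _] := lpnorm_leP x (lpnorm_ge0 x); apply.
Qed.

Lemma lpnorm0_eq0 (x : lpsum p1 X) : lpnorm x = 0 -> x = 0.
Proof.
move=> x0; apply: lpsum_eq => i /=.
have [+ _] := lpnorm_leP x (lexx 0); rewrite x0 => /(_ (lexx _) [fset i]%fset).
rewrite big_seq_fset1 powR0 ?gt_eqF// => h.
apply/eqP; rewrite -normr_eq0; apply/eqP/(@powR_eq0_eq0 _ _ p).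
by apply/eqP; rewrite eq_le h powR_ge0.
Qed.

Lemma lpnormZ (c : R) (x : lpsum p1 X) : lpnorm (c *: x) = `|c| * lpnorm x.
Proof.
apply/eqP; rewrite eq_le lpnormZ_le/=.
have [->|c0] := eqVneq c 0; first by rewrite normr0 mul0r lpnorm_ge0.
rewrite -ler_pdivlMl ?normr_gt0// -normfV.
by rewrite -{1}[x](scalerK c0) lpnormZ_le.
Qed.

HB.instance Definition _ := Lmodule_isNormed.Build R (lpsum p1 X)
  lpnormD lpnormZ lpnorm0_eq0.

Lemma lpsum_normE (x : lpsum p1 X) : `|x| = lpnorm x.
Proof. by []. Qed.

Lemma lpsumD_coord (x y : lpsum p1 X) (i : I) : (x + y) i = x i + y i.
Proof. by []. Qed.

Lemma lpsumZ_coord (c : R) (x : lpsum p1 X) (i : I) : (c *: x) i = c *: x i.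
Proof. by []. Qed.

Lemma lpsum_norm_coord (x : lpsum p1 X) (i : I) : `|x i| <= `|x|.
Proof.
have [+ _] := lpnorm_leP x (lpnorm_ge0 x).
move=> /(_ (lexx _) [fset i]%fset); rewrite big_seq_fset1 => h.
rewrite leNgt; apply/negP => xi; move: h; rewrite leNgt => /negP; apply.
by apply: gt0_ltr_powR => //; rewrite ?nnegrE ?lpnorm_ge0.
Qed.

Lemma lpsum_complete (F : set_system (lpsum p1 X)) :
  ProperFilter F -> cauchy F -> cvg F.
Proof.
move=> FF /cauchyP Fc.
have Fi i : cvg ((fun x : lpsum p1 X => x i) @ F).
  apply: cauchy_cvg; apply/cauchy_exP => e e0.
  have [x Fx] := Fc _ e0; exists (x i).
  rewrite /fmap/=; apply: filterS Fx => y; rewrite -!ball_normE/=.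
  by apply: le_lt_trans; exact: (lpsum_norm_coord (x - y)).
pose l i : X i := lim ((fun x : lpsum p1 X => x i) @ F).
have Fl i : (fun x : lpsum p1 X => x i) @ F --> l i := Fi i.
have near_l (x : lpsum p1 X) e (A : {fset I}) : 0 < e -> F (ball x e) ->
    \sum_(i <- A) `|x i - l i| `^ p <= (e + e) `^ p.
  move=> e0 Fx.
  pose n : R := (size (A : seq I)).+1%:R.
  have n0 : 0 < n by rewrite ltr0n.
  have FA : F [set y | forall i, i \in A -> `|l i - y i| <= e / n].
    suff : F (\bigcap_(i in [set` A])
        [set y : lpsum p1 X | `|l i - y i| <= e / n]) by apply: filterS.
    apply: filter_bigI => i _.
    by have /cvgrPdist_le := Fl i; apply; rewrite divr_gt0.
  have [y [/= xy yA]] := filter_ex (filterI Fx FA).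
  apply: (@le_trans _ _ (\sum_(i <- A) (`|x i - y i| + `|y i - l i|) `^ p)).
    apply: ler_sum => i _.
    by apply: powR_le; rewrite // ler_distD.
  apply: minkowski_fin => //.
    move: xy; rewrite -ball_normE/= => /ltW xy.
    by have [+ _] := lpnorm_leP (x - y) (ltW e0); apply.
  apply: (@le_trans _ _ (\sum_(i <- A) (e / n) `^ p)).
    rewrite !big_seq; apply: ler_sum => i iA.
    by apply: powR_le; rewrite // distrC; exact: yA.
  rewrite big_const_seq count_predT iter_addr_0 -mulr_natl.
  have {2}-> : e = n * (e / n) by rewrite mulrC divfK ?gt_eqF.
  have en0 : 0 < e / n by rewrite divr_gt0.
  rewrite powRM ?(ltW n0) ?(ltW en0)// ler_wpM2r ?powR_ge0//.
  apply: (@le_trans _ _ n); first by rewrite ler_nat.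
  by rewrite -[leLHS]powRr1 ?(ltW n0)// ler_powR// ler1n.
have subl_fin (x : lpsum p1 X) e : 0 < e -> F (ball x e) ->
    (lpenergy (fun i => x i - l i)%R < +oo)%E.
  by move=> e0 Fx; apply: lpfin => A; exact: near_l e0 Fx.
have [x0 Fx0] := Fc _ (@ltr01 R).
pose d0 := LpSum p1 (subl_fin _ _ ltr01 Fx0).
apply/cvg_ex; exists (x0 - d0 : lpsum p1 X).
apply/cvgrPdist_le => e e0.
have e3 : 0 < e / 3 by rewrite divr_gt0.
have [x Fx] := Fc _ e3.
near_simpl; apply: (filterS _ Fx) => y xy /=.
have -> : x0 - d0 - y = (x - y) - (x - (x0 - d0)) :> lpsum p1 X.
  by rewrite opprB [RHS]addrC addrA addrNK.
rewrite (le_trans (ler_normB _ _))//.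
have -> : e = e / 3 + (e / 3 + e / 3).
  by rewrite -!mulrDl -!mulr2n -mulrS -[e *+ 3]mulr_natr mulfK// pnatr_eq0.
apply: lerD; first by move: xy; rewrite -ball_normE/= => /ltW.
apply/lpnorm_leP; first by rewrite addr_ge0 ?ltW.
move=> A; have := near_l _ _ A e3 Fx; apply: le_trans.
apply: ler_sum => i _.
rewrite (_ : (x - (x0 - d0) : lpsum p1 X) i = x i - l i)//.
have -> : (x - (x0 - d0) : lpsum p1 X) i = x i - (x0 i - (x0 i - l i)) by [].
by rewrite subKr.
Qed.

HB.instance Definition _ :=
  Uniform_isComplete.Build (lpsum p1 X) lpsum_complete.

End LpSum.

Definition lp_space (R : realType) (p : R) (p1 : 1 <= p) (G : choiceType) :
    completeNormedModType R :=
  lpsum p1 (fun _ : G => R^o : completeNormedModType R).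

(* The summands are indexed by k = 1, 2, ...; q 0 and G 0 are not used. *)
Definition Xspace (R : realType) (p : R) (p1 : 1 <= p)
    (q : nat -> R) (q1 : forall k, (0 < k)%N -> 1 <= q k)
    (G : nat -> choiceType) : completeNormedModType R :=
  lpsum p1 (fun k : nat => lp_space (q1 k.+1 (ltn0Sn k)) (G k.+1)).

Section NormedSpaceNotions.
Context (R : realType) (V : normedModType R).

Definition separated (r : R) (P : set V) : Prop :=
  forall x y, P x -> P y -> x <> y -> r <= `|x - y|.

Definition r_dense (r : R) (P : set V) : Prop :=
  forall x, exists2 q, P q & `|x - q| <= r.

Definition gamma : R :=
  inf [set r : R | 0 < r /\ exists P : set V, r_dense r P /\ separated 2 P].

Definition finite_dim_subspace (Z : set V) : Prop :=
  exists (n : nat) (e : 'I_n -> V),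
    Z = [set \sum_(i < n) a i *: e i | a in [set: 'I_n -> R]].

Definition octahedral : Prop :=
  forall Z : set V, finite_dim_subspace Z -> forall e : R, 0 < e ->
  exists2 x : V, `|x| = 1 &
    forall z : V, Z z -> forall l : R,
      (1 - e) * (`|z| + `|l|) <= `|z + l *: x|.

Record dual := Dual {
  dual_fun :> V -> R ;
  dual_linear : linear (dual_fun : V -> R^o) ;
  dual_continuous : continuous (dual_fun : V -> R^o) }.

Lemma dual_eq (f g : dual) : (forall x, f x = g x) -> f = g.
Proof.
case: f g => [f f1 f2] [g g1 g2] /= fg.
have {}fg : f = g by apply: funext.
by subst g; congr Dual; exact: Prop_irrelevance.
Qed.

Definition dual_zero : dual.
Proof.
refine (@Dual (fun=> 0) _ _); last by move=> x; exact: cvg_cst.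
by move=> a x y; rewrite scaler0 addr0.
Defined.

Definition dual_opp (f : dual) : dual.
Proof.
refine (@Dual (fun x => - f x) _ _).
  by move=> a x y; rewrite dual_linear opprD scalerN.
by move=> x; apply: (@cvgN _ R^o); exact: dual_continuous.
Defined.

Definition dual_add (f g : dual) : dual.
Proof.
refine (@Dual (fun x => f x + g x) _ _).
  by move=> a x y; rewrite !dual_linear scalerDr addrACA.
by move=> x; apply: (@cvgD _ R^o); exact: dual_continuous.
Defined.

Definition dual_scale (c : R) (f : dual) : dual.
Proof.
refine (@Dual (fun x => c * f x) _ _).
  by move=> a x y; rewrite dual_linear mulrDr/= /GRing.scale/= mulrCA.
by move=> x; apply: (@cvgZr _ R^o); exact: dual_continuous.
Defined.

HB.instance Definition _ := gen_eqMixin dual.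
HB.instance Definition _ := gen_choiceMixin dual.

Lemma dual_addA : associative dual_add.
Proof. by move=> f g h; apply: dual_eq => x /=; rewrite addrA. Qed.

Lemma dual_addC : commutative dual_add.
Proof. by move=> f g; apply: dual_eq => x /=; rewrite addrC. Qed.

Lemma dual_add0 : left_id dual_zero dual_add.
Proof. by move=> f; apply: dual_eq => x /=; rewrite add0r. Qed.

Lemma dual_addN : left_inverse dual_zero dual_opp dual_add.
Proof. by move=> f; apply: dual_eq => x /=; rewrite addNr. Qed.

HB.instance Definition _ :=
  GRing.isZmodule.Build dual dual_addA dual_addC dual_add0 dual_addN.

Lemma dual_scaleA (a b : R) (f : dual) :
  dual_scale a (dual_scale b f) = dual_scale (a * b) f.
Proof. by apply: dual_eq => x /=; rewrite mulrA. Qed.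

Lemma dual_scale1 : left_id 1 dual_scale.
Proof. by move=> f; apply: dual_eq => x /=; rewrite mul1r. Qed.

Lemma dual_scaleDr : right_distributive dual_scale +%R.
Proof. by move=> a f g; apply: dual_eq => x /=; rewrite mulrDr. Qed.

Lemma dual_scaleDl (f : dual) : {morph dual_scale^~ f : a b / a + b}.
Proof. by move=> a b; apply: dual_eq => x /=; rewrite mulrDl. Qed.

HB.instance Definition _ := GRing.Zmodule_isLmodule.Build R dual
  dual_scaleA dual_scale1 dual_scaleDr dual_scaleDl.

Definition dual_ball_values (f : dual) : set R :=
  [set `|f x| | x in [set x : V | `|x| <= 1]].

Definition dual_norm (f : dual) : R := sup (dual_ball_values f).

Lemma dualZ (f : dual) (a : R) (x : V) : f (a *: x) = a * f x.
Proof.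
have f0 : f 0 = 0.
  have := dual_linear f 1 0 0; rewrite !scale1r addr0 => /eqP.
  by rewrite -subr_eq0 opprD addrA subrr add0r oppr_eq0 => /eqP.
by have := dual_linear f a x 0; rewrite !addr0 f0 addr0.
Qed.

Lemma dual_ball_has_sup (f : dual) : has_sup (dual_ball_values f).
Proof.
split; first by exists `|f 0|, 0 => //=; rewrite normr0.
pose L := GRing.isLinear.Build R V R^o _ (dual_fun f) (dual_linear f).
pose g : {linear V -> R^o} := HB.pack (dual_fun f : V -> R^o) L.
have /linear_boundedP : bounded_near g (nbhs (0 : V)).
  by apply: continuous_linear_bounded; exact: dual_continuous.
case=> M [Mreal /(_ (M + 1))]; rewrite ltrDl => /(_ ltr01) h.
exists `|M + 1| => _ [x /= x1 <-].
apply: (le_trans (h x)); apply: (le_trans (ler_norm _)).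
by rewrite normrM normr_id ler_piMr.
Qed.

Lemma dual_norm_ge0 (f : dual) : 0 <= dual_norm f.
Proof.
apply: (le_trans (normr_ge0 (f 0))); apply: ub_le_sup.
  by case: (dual_ball_has_sup f).
by exists 0 => //=; rewrite normr0.
Qed.

Lemma dual_norm_le (f : dual) (x : V) : `|f x| <= dual_norm f * `|x|.
Proof.
have [->|x0] := eqVneq x 0.
  by rewrite -(scale0r (0 : V)) dualZ mul0r normr0 mulr_ge0 ?dual_norm_ge0.
rewrite -ler_pdivrMr ?normr_gt0// mulrC -[X in X * _]gtr0_norm ?invr_gt0 ?normr_gt0//.
rewrite -normrM -dualZ; apply: ub_le_sup; first by case: (dual_ball_has_sup f).
exists (`|x|^-1 *: x) => //=.
by rewrite normrZ normfV normr_id mulVf ?normr_eq0.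
Qed.

Lemma dual_normD (f g : dual) : dual_norm (f + g) <= dual_norm f + dual_norm g.
Proof.
apply: ge_sup; first by case: (dual_ball_has_sup (f + g)).
move=> _ [x /= x1 <-]; apply: (le_trans (ler_normD _ _)); apply: lerD.
  by apply: (le_trans (dual_norm_le f x)); rewrite ler_piMr ?dual_norm_ge0.
by apply: (le_trans (dual_norm_le g x)); rewrite ler_piMr ?dual_norm_ge0.
Qed.

Lemma dual_normZ_le (c : R) (f : dual) :
  dual_norm (c *: f) <= `|c| * dual_norm f.
Proof.
apply: ge_sup; first by case: (dual_ball_has_sup (c *: f)).
move=> _ [x /= x1 <-]; rewrite normrM ler_wpM2l//.
by apply: (le_trans (dual_norm_le f x)); rewrite ler_piMr ?dual_norm_ge0.
Qed.

Lemma dual_normZ (c : R) (f : dual) : dual_norm (c *: f) = `|c| * dual_norm f.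
Proof.
apply/eqP; rewrite eq_le dual_normZ_le/=.
have [->|c0] := eqVneq c 0; first by rewrite normr0 mul0r dual_norm_ge0.
rewrite -ler_pdivlMl ?normr_gt0// -normfV.
by rewrite -{1}[f](scalerK c0) dual_normZ_le.
Qed.

Lemma dual_norm0_eq0 (f : dual) : dual_norm f = 0 -> f = 0.
Proof.
move=> f0; apply: dual_eq => x /=; apply/eqP; rewrite -normr_le0.
by apply: (le_trans (dual_norm_le f x)); rewrite f0 mul0r.
Qed.

HB.instance Definition _ := Lmodule_isNormed.Build R dual
  dual_normD dual_normZ dual_norm0_eq0.

Lemma dual_normE (f : dual) : `|f| = sup [set `|f x| | x in [set x | `|x| <= 1]].
Proof. by []. Qed.

Lemma dualD_coord (f g : dual) (x : V) : (f + g) x = f x + g x.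
Proof. by []. Qed.

Lemma dualZ_coord (c : R) (f : dual) (x : V) : (c *: f) x = c * f x.
Proof. by []. Qed.

End NormedSpaceNotions.

Section Reflexivity.
Context (R : realType) (V : normedModType R).

Lemma bidual_eval_linear (x : V) :
  linear ((fun f : dual V => f x) : dual V -> R^o).
Proof. by []. Qed.

Lemma bidual_eval_continuous (x : V) :
  continuous ((fun f : dual V => f x) : dual V -> R^o).
Proof.
move=> f; apply/(@cvgrPdist_le _ _ _ (nbhs f)) => e e0.
have d0 : 0 < e / (`|x| + 1) by rewrite divr_gt0// ltr_wpDl.
apply/nbhs_ballP; exists (e / (`|x| + 1)) => //= g.
rewrite -ball_normE/= => /ltW fg.
rewrite (_ : f x - g x = (f - g) x)//.
apply: (le_trans (dual_norm_le (f - g) x)).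
apply: (le_trans (ler_wpM2r (normr_ge0 x) fg)).
by rewrite mulrAC ler_pdivrMr ?ltr_wpDl// ler_wpM2l ?ltW// ltrDl.
Qed.

Definition bidual_embedding (x : V) : dual (dual V) :=
  Dual (@bidual_eval_linear x) (@bidual_eval_continuous x).

Definition reflexive_space : Prop :=
  forall phi : dual (dual V), exists x : V, bidual_embedding x = phi.

End Reflexivity.

(* Main.v *)
Require Import Defs.
From HB Require Import structures.
From mathcomp Require Import all_boot all_order all_algebra finmap.
From mathcomp Require Import ring lra.
From mathcomp Require Import all_classical all_reals all_analysis.

Set Implicit Arguments.
Unset Strict Implicit.
Unset Printing Implicit Defensive.

Import Order.TTheory GRing.Theory Num.Theory.
Import numFieldNormedType.Exports.

Local Open Scope classical_set_scope.
Local Open Scope ring_scope.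

(** Why the theorem is true.

    The value of gamma. A maximal [2]-separated set is [2]-dense, so gamma is at
    most [2] in every normed space. Conversely, let [P] be [r]-dense with [r < 2],
    and let [r < r' < 2]. Fix [m]. Suppose that every ball of radius [r'] contains
    at most aleph_m points of [P]. Then, from any position, there is a basis
    vector of the summand with index set omega_(m+1) off the supports of the
    differences of that position with all points of [P] near it, since these
    supports are countable. Moving along it by small steps, again and again with a new vector, one gets farther than [r]
    from all of [P]: a contradiction. Hence some ball of radius [r'] contains more
    than aleph_m points of [P] ([exists_crowded_ball]).

    Approximate these points, relative to the centre of the ball, by finitely
    supported vectors with rational entries. There are countably many shapes of
    such vectors, and a union of at most aleph_m sets of cardinal at most aleph_m
    has cardinal at most aleph_m (because aleph_m is its own square,
    [card_le_square]). So a pigeonhole argument in the style of the Delta-system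
    lemma ([tuple_pair]) gives two points whose approximants have the same shape,
    coincide on the summands over index sets of cardinal at most aleph_m, and
    elsewhere are disjoint except for entries that they share. On a summand
    l_s the difference has norm at most [2^(1/s)] times that of either one; so the
    two points are at distance about [2^(1/s) r'] at most, where [s] is the least
    exponent of the remaining summands ([crowded_ball_pair]). As the exponents
    tend to infinity, this is less than [2] for large [m], and [P] is not
    [2]-separated.

    Octahedrality. On a finite-dimensional subspace of an l_1-sum the coordinates
    tend to [0] uniformly on the unit ball ([finite_dim_uniform_tail]), so a unit
    vector of a late summand is almost disjoint from the whole subspace.

    Reflexivity. An l_p-sum of reflexive spaces is reflexive for [p > 1]
    ([lpsum_reflexive]); this is applied to the l_q spaces, as sums of real lines,
    and then to their sum. A bidual functional gives a point in every summand.
    Extremal functionals of Hoelder's inequality show that these points form an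
    element of the sum, and the functionals that depend on finitely many
    coordinates are dense in the dual because [p > 1] ([dual_tail]). *)

(** * Cardinals *)

Local Open Scope card_scope.

Lemma card_le_inj (T U : Type) (A : set T) (B : set U) (f : T -> U) :
  (forall x, A x -> B (f x)) ->
  (forall x y, A x -> A y -> f x = f y -> x = y) -> A #<= B.
Proof.
move=> fAB finj.
have /injfunPex[g] : exists2 f : T -> U, set_fun A B f & set_inj A f.
  by exists f => // x y /set_mem Ax /set_mem Ay; exact: finj.
exact: inj_card_le.
Qed.

Lemma card_le_injP (T U : Type) (A : set T) (B : set U) : inhabited U ->
  A #<= B -> exists f : T -> U, (forall x, A x -> B (f x)) /\
    (forall x y, A x -> A y -> f x = f y -> x = y).
Proof.
elim/Ppointed: U => U in B *; first by case=> u; have := no (u : U).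
move=> _ /pcard_leP[f]; exists f; split=> [x|x y Ax Ay]; first exact: funS.
by apply: inj; exact: mem_set.
Qed.

(** An injective relation is often at hand where a function would have to be
    chosen. *)
Lemma card_le_rel (T U : Type) (A : set T) (B : set U) (r : T -> U -> Prop) :
  (forall x, A x -> exists2 y, B y & r x y) ->
  (forall x x' y, A x -> A x' -> r x y -> r x' y -> x = x') -> A #<= B.
Proof.
move=> rex rinj.
have [->|/set0P[a0 Aa0]] := eqVneq A set0; first exact: card_ge0.
have [u0 _ _] := rex _ Aa0.
have /choice[f fP] : forall x, exists y, A x -> B y /\ r x y.
  move=> x; have [/rex[y By rxy]|nAx] := pselect (A x); first by exists y.
  by exists u0.
apply: (@card_le_inj _ _ _ _ f) => [x /fP[]//|x y Ax Ay fxy].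
by have [_ rx] := fP _ Ax; have [_ ry] := fP _ Ay; apply: rinj Ax Ay rx _; rewrite fxy.
Qed.

(** A maximal partial injection between the two sets is total on one side. *)
Lemma card_le_total (T U : Type) (A : set T) (B : set U) :
  A #<= B \/ B #<= A.
Proof.
(* Partial injections, as graphs. *)
pose good (Y : set (T * U)) := [/\ forall u, Y u -> A u.1 /\ B u.2,
  (forall u v, Y u -> Y v -> u.1 = v.1 -> u = v) &
  (forall u v, Y u -> Y v -> u.2 = v.2 -> u = v)].
have [F Fgood Ftot|Y [[YAB Y1 Y2] Ymax]] := @Zorn_bigcup _ good.
  split=> [u [Y FY Yu]|u v [Y FY Yu] [Z FZ Zv]|u v [Y FY Yu] [Z FZ Zv]].
  - by have [+ _ _] := Fgood _ FY; apply.
  - have [YZ|ZY] := Ftot _ _ FY FZ.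
      by have [_ + _] := Fgood _ FZ; apply => //; exact: YZ.
    by have [_ + _] := Fgood _ FY; apply => //; exact: ZY.
  - have [YZ|ZY] := Ftot _ _ FY FZ.
      by have [_ _] := Fgood _ FZ; apply => //; exact: YZ.
    by have [_ _] := Fgood _ FY; apply => //; exact: ZY.
have [allA|] := pselect (forall x, A x -> exists y, Y (x, y)).
  left; apply: (@card_le_rel _ _ _ _ (fun x y => Y (x, y))).
    by move=> x /allA[y Yxy]; exists y => //; have [] := YAB _ Yxy.
  by move=> x x' y _ _ Yx Yx'; have [] := Y2 _ _ Yx Yx' erefl.
move=> /existsNP[x /not_implyP[Ax /forallNP nYx]]; right.
apply: (@card_le_rel _ _ _ _ (fun y x => Y (x, y))); last first.
  by move=> y y' x' _ _ Yy Yy'; have [] := Y1 _ _ Yy Yy' erefl.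
move=> y By; apply: contrapT => nYy; apply: (Ymax (Y `|` [set (x, y)])).
  split; first exact: subsetUl.
  by move=> /(_ (x, y)) h; apply: (nYx y); apply: h; right.
have nYy' x' : ~ Y (x', y).
  by move=> Yx'; apply: nYy; exists x' => //; have [] := YAB _ Yx'.
split.
- by move=> u [/YAB//|->].
- move=> [u1 u2] [v1 v2] [Yu|[-> ->]] [Yv|[-> ->]] //= e; first exact: Y1.
    by subst u1; case: (nYx u2).
  by subst v1; case: (nYx v2).
- move=> [u1 u2] [v1 v2] [Yu|[-> ->]] [Yv|[-> ->]] //= e; first exact: Y2.
    by subst u2; case: (nYy' u1).
  by subst v2; case: (nYy' v1).
Qed.

Lemma card_le_bigcup (I T U : Type) (D : set I) (F : I -> set T) (B : set U) :
  B `*` B #<= B -> D #<= B -> (forall i, D i -> F i #<= B) ->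
  \bigcup_(i in D) F i #<= B.
Proof.
move=> BB DB FB.
have [->|/set0P[x0 [i0 Di0 Fi0]]] := eqVneq (\bigcup_(i in D) F i) set0.
  exact: card_ge0.
have [u0 _] : exists u, B u.
  apply/set0P; apply/negP => /eqP B0; move: DB.
  by rewrite B0 card_le0 => /eqP D0; rewrite D0 in Di0.
have uU : inhabited U by constructor.
have [d [dB dinj]] := card_le_injP uU DB.
have [e [eB einj]] := card_le_injP uU BB.
have /choice[f fP] : forall i, exists f : T -> U, D i ->
    (forall x, F i x -> B (f x)) /\
    (forall x y, F i x -> F i y -> f x = f y -> x = y).
  move=> i; have [/FB/(card_le_injP uU)[f fP]|nDi] := pselect (D i); first by exists f.
  by exists (fun=> u0).
apply: (@card_le_rel _ _ _ _
  (fun x u => exists i, [/\ D i, F i x & u = e (d i, f i x)])).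
  move=> x [i Di Fx]; exists (e (d i, f i x)); last by exists i.
  by apply: eB; split=> /=; [exact: dB|have [+ _] := fP i Di; apply].
move=> x y u _ _ [i [Di Fix ->]] [j [Dj Fjy]] ee.
have di : (B `*` B) (d i, f i x).
  by split=> /=; [exact: dB|have [+ _] := fP i Di; apply].
have dj : (B `*` B) (d j, f j y).
  by split=> /=; [exact: dB|have [+ _] := fP j Dj; apply].
have [dij fxy] := einj _ _ di dj ee.
have ij := dinj _ _ Di Dj dij; subst j.
by have [_ +] := fP i Di; apply.
Qed.

Lemma card_le_setX (T T' U U' : Type) (A : set T) (A' : set T')
    (B : set U) (B' : set U') :
  A #<= B -> A' #<= B' -> A `*` A' #<= B `*` B'.
Proof.
have [->|/set0P[[x x'] [/= Ax A'x']]] := eqVneq (A `*` A') set0.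
  by move=> _ _; exact: card_ge0.
move=> AB A'B'.
have [u _] : exists u, B u.
  apply/set0P; apply/negP => /eqP B0; move: AB.
  by rewrite B0 card_le0 => /eqP D0; rewrite D0 in Ax.
have [u' _] : exists u, B' u.
  apply/set0P; apply/negP => /eqP B0; move: A'B'.
  by rewrite B0 card_le0 => /eqP D0; rewrite D0 in A'x'.
have [f [fB finj]] := card_le_injP (inhabits u) AB.
have [g [gB ginj]] := card_le_injP (inhabits u') A'B'.
apply: (@card_le_inj _ _ _ _ (fun v => (f v.1, g v.2))).
  by move=> v [/= v1 v2]; split => /=; [exact: fB|exact: gB].
move=> [a a'] [b b'] [/= Aa Aa'] [/= Ab Ab'] /= [fab gab].
by rewrite (finj _ _ Aa Ab fab) (ginj _ _ Aa' Ab' gab).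
Qed.

Lemma card_le_setU (T U : Type) (A A' : set T) (B : set U) :
  B `*` B #<= B -> infinite_set B -> A #<= B -> A' #<= B -> A `|` A' #<= B.
Proof.
move=> BB Binf AB A'B.
have -> : A `|` A' = \bigcup_(b in [set: bool]) (if b then A else A').
  apply/seteqP; split=> [x [Ax|Ax]|x [[] _ ?]]; [by exists true|by exists false|by left|by right].
apply: card_le_bigcup => // [|[] _//].
apply: (@card_le_trans _ _ _ [set: nat]); last exact/infiniteP.
exact: countableP.
Qed.

(** Among the injections of [D * D] into [D], for [D] inside [B], one that is
    maximal has [D] as large as [B]: otherwise [B] contains a copy [D'] of [D]
    disjoint from it, and the part of the square of [D U D'] that lies outside
    [D * D], whose cardinal is at most that of [D], can be sent into [D']. *)
Lemma card_le_square (T : Type) (B : set T) : infinite_set B -> B `*` B #<= B.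
Proof.
move=> Binf.
(* [Y] is the graph of an injection of [dom Y * dom Y] into [dom Y]; its domain
   can be read off the diagonal. *)
pose dom (Y : set (T * T * T)) := [set a | exists c, Y (a, a, c)].
pose good Y := [/\
  forall a b c, Y (a, b, c) -> [/\ dom Y a, dom Y b & dom Y c],
  forall a b, dom Y a -> dom Y b -> exists c, Y (a, b, c),
  (forall u v c, Y (u, c) -> Y (v, c) -> u = v) &
  dom Y `<=` B].
have good_square Y : good Y -> dom Y `*` dom Y #<= dom Y.
  case=> Yd Ytot Yinj _.
  apply: (@card_le_rel _ _ _ _ (fun u c => Y (u, c))) => [[a b] [/= da db]|u v c _ _].
    by have [c Yc] := Ytot _ _ da db; exists c => //; have [] := Yd _ _ _ Yc.
  exact: Yinj.
have good_bigcup F : F !=set0 -> F `<=` good -> total_on F subset ->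
    good (\bigcup_(Y in F) Y).
  move=> _ Fgood Ftot.
  have domS Y : F Y -> dom Y `<=` dom (\bigcup_(Y in F) Y).
    by move=> FY a [c Yc]; exists c; exists Y.
  split.
  - move=> a b c [Y FY Yabc]; have [+ _ _ _] := Fgood _ FY.
    by move=> /(_ _ _ _ Yabc)[? ? ?]; split; apply: (domS Y).
  - move=> a b [c [Y FY Yac]] [d [Z FZ Zbd]].
    have [YZ|ZY] := Ftot _ _ FY FZ.
      have [_ + _ _] := Fgood _ FZ => /(_ a b)[||e Ze].
      + by exists c; exact: YZ.
      + by exists d.
      + by exists e, Z.
    have [_ + _ _] := Fgood _ FY => /(_ a b)[||e Ye].
    + by exists c.
    + by exists d; exact: ZY.
    + by exists e, Y.
  - move=> u v c [Y FY Yu] [Z FZ Zv].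
    have [YZ|ZY] := Ftot _ _ FY FZ.
      by have [_ _ + _] := Fgood _ FZ; apply; [exact: YZ Yu|exact: Zv].
    by have [_ _ + _] := Fgood _ FY; apply; [exact: Yu|exact: ZY Zv].
  - by move=> a [c [Y FY Yac]]; have [_ _ _] := Fgood _ FY; apply; exists c.
have [f [fB finj]] : exists f : nat -> T, (forall n, B (f n)) /\ injective f.
  have /infiniteP Bnat := Binf; have [b0 _] := infinite_setN0 Binf.
  have [f [fB finj]] := card_le_injP (inhabits b0) Bnat.
  by exists f; split=> [n|m n]; [exact: fB|exact: finj].
have [e [_ einj]] : exists e : nat * nat -> nat,
    (forall u, [set: nat * nat] u -> [set: nat] (e u)) /\
    (forall u v, [set: nat * nat] u -> [set: nat * nat] v -> e u = e v -> u = v).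
  apply: card_le_injP; [exact: inhabits 0%N|by have := card_nat2; rewrite card_eq_le => /andP[]].
(* All graphs contain [Y0], so that their domains are infinite. *)
pose Y0 : set (T * T * T) := [set (f m, f n, f (e (m, n))) | m in setT & n in setT].
have domY0 a : dom Y0 a <-> exists n, a = f n.
  split=> [[c [m _ [n _ [<- _ _]]]]|[n ->]]; first by exists m.
  by exists (f (e (n, n))), n => //; exists n.
have goodY0 : good Y0.
  split.
  - by move=> a b c [m _ [n _ [<- <- <-]]]; split; apply/domY0; eexists.
  - by move=> a b /domY0[m ->] /domY0[n ->]; exists (f (e (m, n))), m => //; exists n.
  - move=> u v c [m _ [n _ [<- <-]]] [m' _ [n' _ [<- /finj h]]].
    by have [-> ->] := einj (m', n') (m, n) I I h.
  - by move=> a /domY0[n ->].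
have [F Fgood Ftot|Y [Ygood Ymax]] := @Zorn_bigcup _ [set Y | good (Y0 `|` Y)].
  have [->|/set0P[Z0 FZ0]] := eqVneq F set0; first by rewrite /= bigcup_set0 setU0.
  rewrite /=; have -> : Y0 `|` \bigcup_(X in F) X = \bigcup_(X in [set Y0 `|` Z | Z in F]) X.
    rewrite bigcup_image; apply/seteqP; split=> [u [Y0u|[Z FZ Zu]]|u [Z FZ [Y0u|Zu]]].
    + by exists Z0 => //; left.
    + by exists Z => //; right.
    + by left.
    + by right; exists Z.
  apply: good_bigcup; first by exists (Y0 `|` Z0), Z0.
    by move=> _ [Z FZ <-]; exact: Fgood.
  move=> _ _ [Z FZ <-] [Z' FZ' <-].
  by have [ZZ'|Z'Z] := Ftot _ _ FZ FZ'; [left|right]; exact: setUS.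
rewrite /= in Ygood; set M := Y0 `|` Y in Ygood; set D := dom M.
have Mmax Z : good Z -> M `<=` Z -> Z `<=` M.
  move=> Zgood MZ; apply: contrapT => ZM; apply: (Ymax Z).
    split; first by move=> u Yu; apply: MZ; right.
    by move=> ZY; apply: ZM => u /ZY; right.
  by rewrite /= (_ : Y0 `|` Z = Z)//; apply/setUidPr => u Y0u; apply: MZ; left.
have Dinf : infinite_set D.
  apply/infiniteP; apply: (@card_le_inj _ _ _ _ f) => [n _|m n _ _]; last exact: finj.
  by exists (f (e (n, n))); left; exists n => //; exists n.
have DD := good_square _ Ygood.
have [Md Mtot Minj DB] := Ygood.
have [BD|DBD] := card_le_total (B `\` D) D.
  have {}BD : B #<= D by rewrite -(setDUK DB); exact: card_le_setU.
  apply: card_le_trans (card_le_setX BD BD) _.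
  by apply: card_le_trans DD _; exact: subset_card_le.
have [d0 Dd0] := infinite_setN0 Dinf.
have [h [hB hinj]] := card_le_injP (inhabits d0) DBD.
pose E := D `|` h @` D.
have ED : E #<= D by apply: card_le_setU => //; exact: card_image_le.
have EED : E `*` E #<= D by apply: card_le_trans DD; exact: card_le_setX.
have [k [kD kinj]] := card_le_injP (inhabits d0) EED.
pose N : set (T * T * T) := M `|`
  [set u | [/\ (E `*` E) u.1, ~ (D `*` D) u.1 & u.2 = h (k u.1)]].
have domN : dom N = E.
  apply/seteqP; split=> [a [c [Mac|[[]//]]]|a Ea]; first by left; exists c.
  have [Da|nDa] := pselect (D a); last by exists (h (k (a, a))); right; split => // -[].
  by have [c Mc] := Da; exists c; left.
have hk u : (E `*` E) u -> ~ D (h (k u)) by move=> /kD/hB[].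
suff : good N.
  move=> /Mmax/(_ (@subsetUl _ _ _))/(_ (h d0, h d0, h (k (h d0, h d0)))) NM.
  have nDh : ~ D (h d0) by have [] := hB _ Dd0.
  case: nDh; exists (h (k (h d0, h d0))); apply: NM; right; split=> //=.
    by split; right; exists d0.
  by case=> /=; have [] := hB _ Dd0.
split; rewrite ?domN.
- move=> a b c [/Md[? ? ?]|[[/= Ea Eb] _ ->]]; first by split; left.
  by split=> //; right; exists (k (a, b)) => //; exact: kD.
- move=> a b Ea Eb; have [[/= Da Db]|nDab] := pselect ((D `*` D) (a, b)).
    by have [c Mc] := Mtot _ _ Da Db; exists c; left.
  by exists (h (k (a, b))); right.
- move=> [a b] [a' b'] c [Mu|[/= Eu nDu ->]] [Mv|[/= Ev nDv cE]].
  + exact: Minj Mu Mv.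
  + by have [_ _] := Md _ _ _ Mu; rewrite cE => /hk-/(_ Ev).
  + by have [_ _] := Md _ _ _ Mv => /hk-/(_ Eu).
  + by apply: kinj => //; apply: hinj => //; exact: kD.
- by move=> a [/DB//|[b /hB[? _] <-]].
Qed.

Lemma has_aleph_infinite k (T : Type) (A : set T) : has_aleph k A -> infinite_set A.
Proof.
elim: k A => [A|k IH A [B [BA /IH Binf _ _]]].
  by rewrite /= card_eq_le => /andP[_ natA]; exact/infiniteP.
exact: sub_infinite_set BA Binf.
Qed.

Lemma card_le_subset (T U : Type) (A : set T) (B : set U) : inhabited U ->
  A #<= B -> exists2 C : set U, C `<=` B & C #= A.
Proof.
move=> uU /(card_le_injP uU)[f [fB finj]]; exists (f @` A).
  by move=> _ [x Ax <-]; exact: fB.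
by apply: inj_card_eq => x y /set_mem Ax /set_mem Ay; exact: finj.
Qed.

(** If [A] embeds in [B] then its copy in [B] either has the cardinal of [B], or
    embeds in the predecessor of [B]; the latter has the cardinal of the
    predecessor of [A] by induction, which does not bound [A]. *)
Lemma has_aleph_uniq k (T U : Type) (A : set T) (B : set U) :
  has_aleph k A -> has_aleph k B -> A #= B.
Proof.
elim: k T U A B => [|k IH] T U A B.
  by move=> /= A0 B0; apply: card_eq_trans A0 _; rewrite card_eq_sym.
move=> Ak Bk; wlog AB : T U A B Ak Bk / A #<= B.
  move=> h; have [AB|BA] := card_le_total A B; first exact: h.
  by rewrite card_eq_sym; exact: h.
have [b0 _] := infinite_setN0 (has_aleph_infinite Bk).
have [C CB CA] := card_le_subset (inhabits b0) AB.
have [B' [B'B B'k nB Bsub]] := Bk; have [A' [A'A A'k nA _]] := Ak.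
have [CB'|CeB] := Bsub _ CB; last first.
  by apply: card_eq_trans CeB; rewrite card_eq_sym.
have A'B' : A' #= B' := IH _ _ _ _ A'k B'k.
exfalso; apply: nA; rewrite (card_le_eqr A'B').
by rewrite -(card_le_eql CA).
Qed.

Lemma has_aleph_le j k (T U : Type) (A : set T) (B : set U) : (j <= k)%N ->
  has_aleph j A -> has_aleph k B -> A #<= B.
Proof.
move=> + Aj; elim: k U B => [|k IH] U B.
  rewrite leqn0 => /eqP j0 Bk; subst j; by have := has_aleph_uniq Aj Bk; rewrite card_eq_le => /andP[].
rewrite leq_eqVlt => /predU1P[jk|jk] Bk.
  by subst j; by have := has_aleph_uniq Aj Bk; rewrite card_eq_le => /andP[].
have [C [CB Ck _ _]] := Bk.
by apply: card_le_trans (IH _ _ jk Ck) _; exact: subset_card_le.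
Qed.

(** A substitute for the Delta-system lemma, for injective [n]-tuples [t a].
    A coordinate with one large fibre is fixed by passing to that fibre. When
    no further coordinate can be fixed, all fibres of the free coordinates are
    small, so the tuples that have a free entry in common with a given tuple
    are few. *)
Lemma tuple_pair (V T U : Type) (B : set U) (A : set V) (n : nat)
    (t : V -> 'I_n -> T) :
  infinite_set B -> ~ (A #<= B) -> (forall a, A a -> injective (t a)) ->
  exists a b, [/\ A a, A b, a <> b,
    forall i l, t a i = t b l -> i = l &
    forall i (D : set T), D #<= B -> (forall c, A c -> D (t c i)) ->
      t a i = t b i].
Proof.
move=> Binf nAB tinj; have BB := card_le_square Binf.
(* [S] is a set of coordinates that are constant on the large set [C]. *)
pose P m := exists (S : {set 'I_n}) (C : set V), [/\ #|S| = m, C `<=` A, ~ (C #<= B) &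
  forall i, i \in S -> forall a b, C a -> C b -> t a i = t b i].
have P0 : exists m, `[< P m >].
  exists 0%N; apply/asboolP; exists (finset.set0), A; rewrite cards0.
  by split => // i; rewrite inE.
have Pn m : `[< P m >] -> (m <= n)%N.
  move=> /asboolP[S [C [<- _ _ _]]]; rewrite -[leqRHS]card_ord; exact: max_card.
have [_ /asboolP[S [C [<- CA nCB fixS]]] Smax] := ex_maxnP P0 Pn.
have fibre i s : i \notin S -> C `&` [set a | t a i = s] #<= B.
  move=> iS; apply: contrapT => nsmall.
  have := Smax #|i |: S|%SET; rewrite cardsU1 iS /= ltnn => /(_ _)-/implyP; apply/negP.
  rewrite implybF negbK; apply/asboolP; exists (i |: S)%SET, (C `&` [set a | t a i = s]).
  split => //; [by rewrite cardsU1 iS|by move=> a [/CA]|].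
  move=> l; rewrite !inE => /predU1P[->|lS] a b [Ca /= ta] [Cb /= tb]; first by rewrite ta.
  exact: fixS.
have [a Ca] : C !=set0.
  by apply/set0P/negP => /eqP C0; apply: nCB; rewrite C0; exact: card_ge0.
have smallcount (I : countType) : [set: I] #<= B.
  apply: (@card_le_trans _ _ _ [set: nat]); last exact/infiniteP.
  exact: countableP.
pose bad := [set b | b = a] `|`
  \bigcup_(il in [set u : 'I_n * 'I_n | u.2 \notin S]) (C `&` [set b | t b il.2 = t a il.1]).
have badB : bad #<= B.
  apply: card_le_setU => //.
    apply: card_le_trans (smallcount unit).
    by apply: (@card_le_inj _ _ _ _ (fun=> tt)) => // x y -> ->.
  apply: card_le_bigcup => // [|[i l] /= lS]; last exact: fibre.
  by apply: card_le_trans (smallcount ('I_n * 'I_n)%type); exact: card_leT.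
have [b Cb nbad] : exists2 b, C b & ~ bad b.
  apply: contrapT => h; apply: nCB; apply: card_le_trans badB.
  apply: subset_card_le => b Cb; apply: contrapT => nb; apply: h; by exists b.
exists a, b; split; [exact: CA|exact: CA|by move=> ab; apply: nbad; left| |].
- move=> i l til; have [lS|lS] := boolP (l \in S).
    by apply: (tinj a); [exact: CA|rewrite til; exact: fixS].
  by exfalso; apply: nbad; right; exists (i, l).
- move=> i D DB tD; have [iS|iS] := boolP (i \in S); first exact: fixS.
  exfalso; apply: nCB.
  have -> : C = \bigcup_(s in D) (C `&` [set a | t a i = s]).
    apply/seteqP; split=> [c Cc|c [s _ []]//].
    by exists (t c i) => //; apply: tD; exact: CA.
  by apply: card_le_bigcup => // s _; exact: fibre.
Qed.

Local Close Scope card_scope.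

(** * Norms in l_p-sums *)

Section LpNorm.
Context (R : realType) (p : R) (p1 : 1 <= p) (I : choiceType).

Let p0 : 0 < p. Proof. exact: lt_le_trans p1. Qed.

Lemma powR_le_inv (x y : R) : 0 <= y -> x `^ p <= y `^ p -> x <= y.
Proof.
move=> y0 xy; rewrite leNgt; apply/negP => yx; move: xy; rewrite leNgt => /negP; apply.
by apply: gt0_ltr_powR => //; rewrite ?nnegrE ?(le_trans y0 (ltW yx)).
Qed.

Lemma powR_inj_ge0 (x y : R) : 0 <= x -> 0 <= y -> x `^ p = y `^ p -> x = y.
Proof.
move=> x0 y0 xy; apply/eqP; rewrite eq_le; apply/andP.
by split; apply: powR_le_inv => //; rewrite xy.
Qed.

Lemma powR_le_double (rho a b c : R) : 0 <= rho -> 2 <= rho `^ p -> 0 <= a ->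
  a = b -> c `^ p <= a `^ p + b `^ p -> c <= rho * a.
Proof.
move=> rho0 rho2 a0 <- h; apply: powR_le_inv; first by rewrite mulr_ge0.
rewrite powRM//; apply: le_trans h _.
by rewrite -mulr2n -mulr_natl ler_wpM2r// powR_ge0.
Qed.

Lemma lp_norm_energy (X : I -> completeNormedModType R) (x : lpsum p1 X) :
  (`|x| `^ p)%:E = lpenergy p x.
Proof.
rewrite lpsum_normE /lpnorm -powRrM mulVf ?gt_eqF// powRr1 ?fine_ge0 ?lpenergy_ge0//.
by rewrite fineK// ge0_fin_numE ?lpenergy_ge0//; exact: lpfunP.
Qed.

Lemma lp_energy_le_add (X Y Z : I -> completeNormedModType R)
    (x : forall i, X i) (y : forall i, Y i) (z : forall i, Z i) :
  (forall i, `|x i| `^ p <= `|y i| `^ p + `|z i| `^ p) ->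
  (lpenergy p x <= lpenergy p y + lpenergy p z)%E.
Proof.
move=> h; rewrite /lpenergy -esumD.
- by apply: le_esum => i _; rewrite -EFinD lee_fin.
- by move=> i _; rewrite lee_fin powR_ge0.
- by move=> i _; rewrite lee_fin powR_ge0.
Qed.

Lemma lp_energy_add_le (X Y Z : I -> completeNormedModType R)
    (x : forall i, X i) (y : forall i, Y i) (z : forall i, Z i) :
  (forall i, `|y i| `^ p + `|z i| `^ p <= `|x i| `^ p) ->
  (lpenergy p y + lpenergy p z <= lpenergy p x)%E.
Proof.
move=> h; rewrite /lpenergy -esumD.
- by apply: le_esum => i _; rewrite -EFinD lee_fin.
- by move=> i _; rewrite lee_fin powR_ge0.
- by move=> i _; rewrite lee_fin powR_ge0.
Qed.

Let fine_le_add (a b c : R) (A B C : \bar R) :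
  a%:E = A -> b%:E = B -> c%:E = C -> (A <= B + C)%E -> a <= b + c.
Proof. by move=> <- <- <-; rewrite -EFinD lee_fin. Qed.

Let fine_add_le (a b c : R) (A B C : \bar R) :
  a%:E = A -> b%:E = B -> c%:E = C -> (B + C <= A)%E -> b + c <= a.
Proof. by move=> <- <- <-; rewrite -EFinD lee_fin. Qed.

Lemma lp_pow_le_add (X Y Z : I -> completeNormedModType R)
    (x : lpsum p1 X) (y : lpsum p1 Y) (z : lpsum p1 Z) :
  (forall i, `|x i| `^ p <= `|y i| `^ p + `|z i| `^ p) ->
  `|x| `^ p <= `|y| `^ p + `|z| `^ p.
Proof.
move=> h; apply: (fine_le_add (lp_norm_energy x) (lp_norm_energy y) (lp_norm_energy z)).
exact: lp_energy_le_add.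
Qed.

Lemma lp_pow_add_le (X Y Z : I -> completeNormedModType R)
    (x : lpsum p1 X) (y : lpsum p1 Y) (z : lpsum p1 Z) :
  (forall i, `|y i| `^ p + `|z i| `^ p <= `|x i| `^ p) ->
  `|y| `^ p + `|z| `^ p <= `|x| `^ p.
Proof.
move=> h; apply: (fine_add_le (lp_norm_energy x) (lp_norm_energy y) (lp_norm_energy z)).
exact: lp_energy_add_le.
Qed.

Lemma lp_norm_le_scale (X Y : I -> completeNormedModType R) (c : R)
    (x : lpsum p1 X) (y : lpsum p1 Y) : 0 <= c ->
  (forall i, `|x i| <= c * `|y i|) -> `|x| <= c * `|y|.
Proof.
move=> c0 h; apply/lpnorm_leP; first by rewrite mulr_ge0.
move=> F; rewrite powRM//.
have [+ _] := lpnorm_leP y (lpnorm_ge0 p y) => /(_ (lexx _) F) yF.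
apply: le_trans (ler_wpM2l (powR_ge0 _ _) yF).
rewrite mulr_sumr; apply: ler_sum => i _.
by rewrite -powRM//; apply: powR_le.
Qed.

Lemma lp_norm_le (X Y : I -> completeNormedModType R)
    (x : lpsum p1 X) (y : lpsum p1 Y) :
  (forall i, `|x i| <= `|y i|) -> `|x| <= `|y|.
Proof.
move=> h; rewrite -[leRHS]mul1r; apply: lp_norm_le_scale => // i.
by rewrite mul1r.
Qed.

Section OneFamily.
Context (X : I -> completeNormedModType R).
Implicit Types x y : lpsum p1 X.

Lemma lp_sum_pow_le x (F : {fset I}) : \sum_(i <- F) `|x i| `^ p <= `|x| `^ p.
Proof. by have [+ _] := lpnorm_leP x (lpnorm_ge0 p x); apply. Qed.

Lemma lprestr_fin (D : pred I) x :
  (lpenergy p (fun i => if D i then x i else 0%R) < +oo)%E.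
Proof.
apply: le_lt_trans (lpfunP x); apply: le_esum => i _; rewrite lee_fin.
by case: ifP => // _; rewrite normr0; apply: powR_le.
Qed.

Definition lprestr (D : pred I) x : lpsum p1 X := LpSum p1 (lprestr_fin D x).

Lemma lprestrE D x i : lprestr D x i = if D i then x i else 0.
Proof. by []. Qed.

Lemma lp_sub_restrE D x i : (x - lprestr D x) i = if D i then 0 else x i.
Proof.
rewrite [LHS](_ : _ = x i - lprestr D x i)// lprestrE.
by case: ifP => _; rewrite ?subrr ?subr0.
Qed.

Lemma lp_norm_restr D x : `|lprestr D x| <= `|x|.
Proof. by apply: lp_norm_le => i; rewrite lprestrE; case: ifP => // _; rewrite normr0. Qed.

Lemma lprestr_linear D : linear (lprestr D).
Proof.
move=> a x y; apply: lpsum_eq => i; rewrite lprestrE lpsumD_coord lpsumZ_coord.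
rewrite [in RHS]lpsumD_coord lpsumZ_coord !lprestrE.
by case: ifP => // _; rewrite scaler0 addr0.
Qed.

(** The sum of the [|x i|^p] over some finite [F] exceeds [|x|^p - e^p], which
    leaves less than [e^p] for the indices outside [F]. *)
Lemma lp_tail x (e : R) : 0 < e ->
  exists F : {fset I}, `|x - lprestr (mem F) x| <= e.
Proof.
move=> e0.
have [F xF] : exists F : {fset I}, `|x| `^ p - e `^ p < \sum_(i <- F) `|x i| `^ p.
  apply: contrapT => /forallNP h.
  have hF (F : {fset I}) : \sum_(i <- F) `|x i| `^ p <= `|x| `^ p - e `^ p.
    by rewrite leNgt; apply/negP; exact: h.
  have : ((`|x| `^ p)%:E <= (`|x| `^ p - e `^ p)%:E)%E.
    by rewrite lp_norm_energy; apply/lpenergy_leP.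
  by rewrite lee_fin lerBrDl gerDr leNgt powR_gt0.
exists F; apply/lpnorm_leP; first exact: ltW.
(* [h] and [g] split the energy over [F U F'] into its parts off and on [F]. *)
move=> F'; pose h i := if i \in F then 0 else `|x i| `^ p.
pose g i := if i \in F then `|x i| `^ p else 0.
have h0 i : 0 <= h i by rewrite /h; case: ifP => // _; exact: powR_ge0.
have -> : \sum_(i <- F') `|(x - lprestr (mem F) x) i| `^ p = \sum_(i <- F') h i.
  apply: eq_bigr => i _; rewrite lp_sub_restrE (_ : mem F i = (i \in F))// /h; case: ifP => // _.
  by rewrite normr0 powR0// gt_eqF.
pose h' i := if i \in F' then h i else 0.
have -> : \sum_(i <- F') h i = \sum_(i <- (F `|` F')%fset) h' i.
  rewrite -(@big_fset_incl _ _ _ _ F' (F `|` F')%fset) ?fsubsetUr//.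
    by rewrite !big_seq; apply: eq_bigr => i iF; rewrite /h' iF.
  by move=> i _ iF; rewrite /h' (negbTE iF).
have gF : \sum_(i <- F) `|x i| `^ p = \sum_(i <- (F `|` F')%fset) g i.
  rewrite -(@big_fset_incl _ _ _ _ F (F `|` F')%fset) ?fsubsetUl//.
    by rewrite !big_seq; apply: eq_bigr => i iF; rewrite /g iF.
  by move=> i _ iF; rewrite /g (negbTE iF).
have xFF' := lp_sum_pow_le x (F `|` F')%fset.
rewrite -(lerD2r (\sum_(i <- F) `|x i| `^ p)).
apply: (@le_trans _ _ (`|x| `^ p)); last by rewrite -lerBlDl ltW.
apply: le_trans xFF'; rewrite gF -big_split/=.
apply: ler_sum => i _; rewrite /h' /h /g.
by case: (i \in F); case: (i \in F') => //; rewrite ?add0r ?addr0// powR_ge0.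
Qed.

Lemma lp_support_countable x : countable [set i | x i != 0].
Proof.
have /choice[F FP] n : exists F : {fset I}, `|x - lprestr (mem F) x| <= n.+1%:R^-1.
  by apply: lp_tail; rewrite invr_gt0.
apply: (@sub_countable _ _ _ (\bigcup_n [set` F n])); last first.
  by apply: bigcup_countable => // n _; exact: countable_fset.
apply: subset_card_le => i /= xi; apply: contrapT => h.
have {}h n : i \notin F n by apply/negP => iF; apply: h; exists n.
move: xi; rewrite -normr_gt0 => xi.
have [n] : exists n, n.+1%:R^-1 < `|x i|.
  by have [n _ nP] := near_infty_natSinv_lt (PosNum xi); exists n; exact: nP (leqnn n).
rewrite ltNge => /negP; apply; apply: le_trans (FP n).
have := lpsum_norm_coord (x - lprestr (mem (F n)) x) i.
by rewrite lp_sub_restrE (_ : mem (F n) i = (i \in F n))// (negbTE (h n)).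
Qed.

Lemma lpsingle_sum i (v : X i) (F : {fset I}) :
  \sum_(j <- F) `|dfwith (fun j => 0 : X j) i v j| `^ p <= `|v| `^ p.
Proof.
have h j : j != i -> `|dfwith (fun j => 0 : X j) i v j| `^ p = 0.
  by move=> ji; rewrite dfwithout 1?eq_sym// normr0 powR0// gt_eqF.
have [iF|iF] := boolP (i \in F); last first.
  rewrite big_seq big1 ?powR_ge0// => j jF; apply: h.
  by apply: contraNneq iF => <-.
rewrite (big_fsetD1 i)//= dfwithin big_seq big1 ?addr0// => j.
by rewrite !inE => /andP[/h].
Qed.

Definition lpsingle i (v : X i) : lpsum p1 X := LpSum p1 (lpfin (lpsingle_sum v)).

Lemma lpsingle_in i (v : X i) : lpsingle v i = v.
Proof. exact: dfwithin. Qed.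

Lemma lpsingle_out i j (v : X i) : j != i -> lpsingle v j = 0.
Proof. by move=> ji; apply: dfwithout; rewrite eq_sym. Qed.

Lemma lpsingle_linear i : linear (@lpsingle i).
Proof.
move=> a u v; apply: lpsum_eq => j; rewrite lpsumD_coord lpsumZ_coord.
have [ji|ji] := eqVneq j i; first by subst j; rewrite !lpsingle_in.
by rewrite !lpsingle_out// scaler0 addr0.
Qed.

Lemma lp_norm_single i (v : X i) : `|lpsingle v| = `|v|.
Proof.
apply/eqP; rewrite eq_le; apply/andP; split.
  apply/lpnorm_leP => // F; exact: lpsingle_sum.
by have := lpsum_norm_coord (lpsingle v) i; rewrite lpsingle_in.
Qed.

Lemma lprestr_sum (F : {fset I}) x :
  lprestr (mem F) x = \sum_(i <- F) lpsingle (x i).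
Proof.
apply: lpsum_eq => j; rewrite lprestrE (_ : mem F j = (j \in F))//.
have -> : (\sum_(i <- F) lpsingle (x i)) j = \sum_(i <- F) lpsingle (x i) j.
  by elim/big_rec2: _ => // i u v _ <-.
have [jF|jF] := ifPn.
  rewrite (big_fsetD1 j)//= dfwithin big_seq big1 ?addr0// => i.
  by rewrite !inE => /andP[ij _]; rewrite dfwithout.
rewrite big_seq big1// => i iF; rewrite lpsingle_out//.
by apply: contraNneq jF => ->.
Qed.

HB.instance Definition _ i := GRing.isLinear.Build R (X i) (lpsum p1 X) _
  (@lpsingle i) (@lpsingle_linear i).

HB.instance Definition _ (D : pred I) := GRing.isLinear.Build R (lpsum p1 X) (lpsum p1 X) _
  (lprestr D) (lprestr_linear D).

Lemma lp_pow_single_add x i (v : X i) : x i = 0 ->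
  `|x| `^ p + `|v| `^ p <= `|x + lpsingle v| `^ p.
Proof.
move=> xi; rewrite -(lp_norm_single v); apply: lp_pow_add_le => j.
rewrite lpsumD_coord; have [ji|ji] := eqVneq j i.
  by subst j; rewrite xi add0r normr0 powR0 ?add0r// gt_eqF.
by rewrite lpsingle_out// addr0 normr0 powR0 ?addr0// gt_eqF.
Qed.

Lemma lpsum_add_single_in x i (v : X i) : (x + lpsingle v) i = x i + v.
Proof. by rewrite lpsumD_coord lpsingle_in. Qed.

Lemma lp_norm_add_single_ge x i (v : X i) :
  `|x i| <= `|x i + v| -> `|x| <= `|x + lpsingle v|.
Proof.
move=> xv; apply: lp_norm_le => j; have [ji|ji] := eqVneq j i.
  by subst j; rewrite lpsum_add_single_in.
by rewrite lpsumD_coord lpsingle_out// addr0.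
Qed.

Lemma lpsumB_coord x y i : (x - y) i = x i - y i.
Proof. by []. Qed.

(** When no index carries two distinct non-zero coordinates, the powers of
    the norms add up as for disjoint supports. *)
Lemma lp_norm_sub_le x y (rho : R) : 0 <= rho -> 2 <= rho `^ p ->
  `|x| = `|y| -> (forall i, [\/ x i = y i, x i = 0 | y i = 0]) ->
  `|x - y| <= rho * `|x|.
Proof.
move=> rho0 rho2 xy xyi; apply: (powR_le_double rho0 rho2 (normr_ge0 x) xy).
apply: lp_pow_le_add => i; rewrite lpsumB_coord; case: (xyi i) => ->.
- by rewrite subrr normr0 powR0 ?gt_eqF// addr_ge0 ?powR_ge0.
- by rewrite sub0r normrN lerDr powR_ge0.
- by rewrite subr0 lerDl powR_ge0.
Qed.

End OneFamily.
End LpNorm.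

Arguments lpsingle {R p} p1 {I X} i v.

(** * Simultaneous packing and covering *)

(** Density says that no point can be added to a maximal [2]-separated set. *)
Lemma exists_dense_separated (R : realType) (V : normedModType R) :
  exists P : set V, r_dense 2 P /\ Defs.separated 2 P.
Proof.
have [F Fsep Ftot|P [Psep Pmax]] := @Zorn_bigcup _ [set P : set V | Defs.separated 2 P].
  move=> x y [P FP Px] [Q FQ Qy]; have [PQ|QP] := Ftot _ _ FP FQ.
    by apply: (Fsep _ FQ) => //; exact: PQ.
  by apply: (Fsep _ FP) => //; exact: QP.
exists P; split=> // x; apply: contrapT => nx.
have far u : P u -> 2 <= `|x - u|.
  move=> Pu; rewrite leNgt; apply/negP => xu; apply: nx; exists u => //.
  exact: ltW.
apply: (Pmax (P `|` [set x])); first split; first exact: subsetUl.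
  move=> /(_ x) h; apply: nx; exists x; first by apply: h; right.
  by rewrite subrr normr0.
move=> u v [Pu|->] [Pv|->] uv //; first exact: Psep.
  by rewrite distrC; exact: far.
exact: far.
Qed.

Lemma gamma_eq2 (R : realType) (V : normedModType R) :
  (forall r (P : set V), 0 < r -> r_dense r P -> Defs.separated 2 P -> 2 <= r) ->
  gamma V = 2.
Proof.
move=> h; have [P [Pd Ps]] := exists_dense_separated V.
apply/eqP; rewrite eq_le; apply/andP; split.
  by apply: ge_inf; [exists 0 => r [/ltW]|split => //; exists P].
apply: lb_le_inf; first by exists 2; split => //; exists P.
by move=> r [r0 [Q [Qd Qs]]]; exact: h Qd Qs.
Qed.

Lemma ler_sum_subseq_support (R : realType) (T : eqType) (h : T -> R) (s1 s2 : seq T) :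
  (forall t, 0 <= h t) -> uniq s1 ->
  (forall t, t \in s1 -> h t != 0 -> t \in s2) ->
  \sum_(t <- s1) h t <= \sum_(t <- s2) h t.
Proof.
move=> h0; elim: s1 s2 => [|x s1 IH] s2 /=; first by rewrite big_nil sumr_ge0.
move=> /andP[xs1 us1] sub; rewrite big_cons.
have [hx|hx] := eqVneq (h x) 0.
  by rewrite hx add0r; apply: IH => // t ts1; apply: sub; rewrite inE ts1 orbT.
have xs2 : x \in s2 by apply: sub; rewrite ?mem_head.
rewrite (perm_big _ (perm_to_rem xs2)) big_cons lerD2l; apply: IH => // t ts1 ht.
have : t \in s2 by apply: sub => //; rewrite inE ts1 orbT.
rewrite (perm_mem (perm_to_rem xs2)) inE => /predU1P[tx|//].
by move: xs1; rewrite -tx ts1.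
Qed.

Section Adherence.
Context (R : realType) (V : normedModType R) (S : set V).
Hypotheses (S0 : S 0) (SD : forall x y, S x -> S y -> S (x + y)).

Definition approximable (x : V) := forall e, 0 < e -> exists2 y, S y & `|x - y| <= e.

Lemma approximable_mem x : S x -> approximable x.
Proof. by move=> rx e e0; exists x => //; rewrite subrr normr0 ltW. Qed.

Lemma approximableD x y : approximable x -> approximable y -> approximable (x + y).
Proof.
move=> ax ay e e0; have e2 : 0 < e / 2 by rewrite divr_gt0.
have [x' Sx xx'] := ax _ e2; have [y' Sy yy'] := ay _ e2.
exists (x' + y'); first exact: SD.
by rewrite opprD addrACA (splitr e); apply: le_trans (ler_normD _ _) (lerD xx' yy').
Qed.

Lemma approximable_sum (J : Type) (s : seq J) (f : J -> V) :
  (forall j, approximable (f j)) -> approximable (\sum_(j <- s) f j).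
Proof.
move=> af; elim: s => [|j s IH].
  by rewrite big_nil; exact: approximable_mem.
by rewrite big_cons; apply: approximableD.
Qed.

Lemma approximable_closed x :
  (forall e, 0 < e -> exists2 y, approximable y & `|x - y| <= e) -> approximable x.
Proof.
move=> ax e e0; have e2 : 0 < e / 2 by rewrite divr_gt0.
have [y ay xy] := ax _ e2; have [z rz yz] := ay _ e2.
exists z => //; rewrite (splitr e) -(subrKA y).
by apply: le_trans (ler_normD _ _) (lerD _ _).
Qed.

End Adherence.

(** Through truncation, it is enough to approximate the vectors that are
    supported by one index. *)
Lemma approximable_lpsum (R : realType) (p : R) (p1 : 1 <= p) (I : choiceType)
    (X : I -> completeNormedModType R) (S : set (lpsum p1 X)) :
  S 0 -> (forall x y, S x -> S y -> S (x + y)) ->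
  (forall i (v : X i), approximable S (lpsingle p1 i v)) ->
  forall x, approximable S x.
Proof.
move=> S0 SD Ssingle x; apply: approximable_closed => e /(lp_tail x)[F xF].
exists (lprestr (mem F) x) => //; rewrite lprestr_sum.
exact: approximable_sum.
Qed.

Lemma approximable_lpsingle (R : realType) (p : R) (p1 : 1 <= p) (I : choiceType)
    (X : I -> completeNormedModType R) (S : set (lpsum p1 X)) i :
  (forall v : X i, approximable [set u | S (lpsingle p1 i u)] v) ->
  forall v : X i, approximable S (lpsingle p1 i v).
Proof.
move=> Si v e /(Si v)[u Su uv]; exists (lpsingle p1 i u) => //.
by rewrite -linearB lp_norm_single.
Qed.

Lemma norm_sub_via (R : realType) (V : normedModType R) (a b x y z : V) :
  `|a - b| <= `|a - x - y| + `|y - z| + `|b - x - z|.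
Proof.
have -> : a - b = (a - x - y) + (y - z) - (b - x - z).
  by rewrite subrKA opprB addrA subrK opprB addrA subrK.
by apply: le_trans (ler_normB _ _) _; rewrite lerD2r; exact: ler_normD.
Qed.

Lemma norm_le_via (R : realType) (V : normedModType R) (a x y : V) :
  `|y| <= `|x - a| + `|a - x - y|.
Proof.
have := ler_normB (a - x) (a - x - y).
by rewrite opprB addrC subrK (distrC a x).
Qed.

Section LpOfLq.
Context (R : realType) (p : R) (p1 : 1 <= p).
Context (q : nat -> R) (q1 : forall k, 1 <= q k) (H : nat -> choiceType).

Local Notation E k := (lpsum (q1 k) (fun _ : H k => R^o : completeNormedModType R)).
Local Notation Y := (lpsum p1 (fun k => lp_space (q1 k) (H k))).
Local Notation T := {k : nat & H k}.

Let q0 k : 0 < q k. Proof. exact: lt_le_trans (q1 k). Qed.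

Definition entry (x : Y) (t : T) : R := (x (tag t) : E (tag t)) (tagged t).

Lemma entryD x y t : entry (x + y) t = entry x t + entry y t.
Proof. by []. Qed.

Definition ratfin (x : Y) := exists2 s : seq T,
  (forall t, t \notin s -> entry x t = 0) & forall t, exists c : rat, entry x t = ratr c.

Lemma ratfin0 : ratfin 0.
Proof. by exists [::] => // t; exists 0; rewrite rmorph0. Qed.

Lemma ratfinD x y : ratfin x -> ratfin y -> ratfin (x + y).
Proof.
move=> [s sx cx] [s' sy cy]; exists (s ++ s') => t; rewrite ?entryD.
  by rewrite mem_cat negb_or => /andP[/sx-> /sy->]; rewrite addr0.
by have [c ->] := cx t; have [d ->] := cy t; exists (c + d); rewrite rmorphD.
Qed.

Lemma entry_single k (g : H k) (c : R) t : t != Tagged H g ->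
  entry (lpsingle p1 k (lpsingle (q1 k) g (c : R^o) : E k)) t = 0.
Proof.
case: t => j h tkg; rewrite /entry /=.
have [jk|jk] := eqVneq j k; last by rewrite dfwithout// eq_sym.
subst j; rewrite dfwithin; apply: dfwithout.
by apply: contraNneq tkg => ->.
Qed.

Lemma entry_single_in k (g : H k) (c : R) :
  entry (lpsingle p1 k (lpsingle (q1 k) g (c : R^o) : E k)) (Tagged H g) = c.
Proof. by rewrite /entry /= dfwithin; exact: dfwithin. Qed.

Lemma ratfin_single k (g : H k) (c : rat) :
  ratfin (lpsingle p1 k (lpsingle (q1 k) g (ratr c : R^o) : E k)).
Proof.
exists [:: Tagged H g] => t; first by rewrite inE => /entry_single.
have [->|/entry_single tg] := eqVneq t (Tagged H g).
  by exists c; rewrite entry_single_in.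
by exists 0; rewrite tg rmorph0.
Qed.

Lemma ratfin_dense (x : Y) : approximable ratfin x.
Proof.
apply: approximable_lpsum; [exact: ratfin0|exact: ratfinD|move=> k].
apply: approximable_lpsingle; apply: approximable_lpsum.
- by rewrite /= linear0; exact: ratfin0.
- by move=> u v /= ru rv; rewrite linearD; exact: ratfinD.
move=> g; apply: approximable_lpsingle => c e e0.
have /rat_in_itvoo[d /itvP cd] : (c : R) < (c : R) + e by rewrite ltrDl.
exists (ratr d : R^o); first exact: ratfin_single.
have {}cd : `|(c : R) - ratr d| <= e.
  by rewrite distrC ger0_norm ?subr_ge0 ?lerBlDl ltW ?cd.
exact: cd.
Qed.

Definition lists_coords (x : Y) (L : seq (T * rat)) := [/\ uniq (unzip1 L),
  (forall u, u \in L -> entry x u.1 = ratr u.2) &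
  forall t, t \notin unzip1 L -> entry x t = 0].

Lemma ratfin_list x : ratfin x -> exists L, lists_coords x L.
Proof.
move=> [s sx /choice[c xc]]; exists [seq (t, c t) | t <- undup s].
have e1 : unzip1 [seq (t, c t) | t <- undup s] = undup s.
  by rewrite /unzip1 -map_comp map_id.
split; rewrite ?e1 ?undup_uniq//.
  by move=> _ /mapP[t _ ->] /=; exact: xc.
by move=> t; rewrite mem_undup; exact: sx.
Qed.

(** Without the positions inside the summands only countably many shapes are
    left; the norms of the coordinates depend on the shape alone. *)
Definition shape_of (L : seq (T * rat)) : seq (nat * rat) :=
  [seq (tag u.1, u.2) | u <- L].

Let entry_pow k x (t : T) := if tag t == k then `|entry x t| `^ q k else 0.

Let entry_pow_ge0 k x t : 0 <= entry_pow k x t.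
Proof. by rewrite /entry_pow; case: ifP => // _; exact: powR_ge0. Qed.

Let entry_pow_shape k x L : lists_coords x L ->
  \sum_(t <- unzip1 L) entry_pow k x t =
  \sum_(v <- shape_of L) if v.1 == k then `|ratr v.2 : R| `^ q k else 0.
Proof.
move=> [_ Lx _]; rewrite /unzip1 /shape_of !big_map !big_seq.
by apply: eq_bigr => u uL; rewrite /entry_pow Lx.
Qed.

Lemma lists_coords_pow k x L : lists_coords x L -> `|x k| `^ q k =
  \sum_(v <- shape_of L) if v.1 == k then `|ratr v.2 : R| `^ q k else 0.
Proof.
move=> xL; rewrite -(entry_pow_shape _ xL); have [uL _ L0] := xL.
have sumF (F : {fset H k}) : \sum_(g <- F) `|(x k : E k) g| `^ q k =
    \sum_(t <- [seq Tagged H g | g <- F]) entry_pow k x t.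
  by rewrite big_map; apply: eq_bigr => g _; rewrite /entry_pow /= eqxx.
have Tinj : injective (fun g : H k => Tagged H g).
  by move=> g h /eqP; rewrite eq_Tagged => /eqP.
apply/eqP; rewrite eq_le; apply/andP; split.
  rewrite -lee_fin (lp_norm_energy (x k : E k)); apply/lpenergy_leP => F; rewrite sumF.
  apply: (ler_sum_subseq_support (entry_pow_ge0 k x)); first by rewrite map_inj_uniq ?fset_uniq.
  move=> t _; rewrite /entry_pow; case: ifP => [_|]; last by rewrite eqxx.
  by apply: contraNT => /L0 ->; rewrite normr0 powR0// gt_eqF.
pose F := fset_set [set g : H k | Tagged H g \in unzip1 L].
apply: le_trans (lp_sum_pow_le (x k : E k) F); rewrite sumF.
apply: (ler_sum_subseq_support (entry_pow_ge0 k x) uL) => -[j g] tL; rewrite /entry_pow /=.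
have [jk _|jk] := eqVneq j k; last by rewrite eqxx.
subst j; apply/mapP; exists g => //; rewrite in_fset_set ?inE//.
by apply: (@finite_preimage _ _ [set` unzip1 L] (fun g : H k => Tagged H g)) => // ? ? _ _; exact: Tinj.
Qed.


Lemma lists_coords_norm k x x' L L' : lists_coords x L -> lists_coords x' L' ->
  shape_of L = shape_of L' -> `|x k| = `|x' k|.
Proof.
move=> xL x'L' LL'.
have e := lists_coords_pow k xL; have e' := lists_coords_pow k x'L'.
apply: (powR_inj_ge0 (q1 k)); [exact: normr_ge0|exact: normr_ge0|].
by apply: etrans e _; rewrite LL'; apply: esym; exact: e'.
Qed.

Lemma entry_nth t0 y L i : lists_coords y L -> (i < size L)%N ->
  entry y (nth t0 (unzip1 L) i) = ratr (nth (0%N, 0) (shape_of L) i).2.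
Proof.
move=> [_ + _] iL => /(_ (nth (t0, 0) L i) (mem_nth _ iL)).
by rewrite (nth_map (t0, 0))// (nth_map (t0, 0)).
Qed.

Lemma tag_nth t0 (L : seq (T * rat)) i : (i < size L)%N ->
  tag (nth t0 (unzip1 L) i) = (nth (0%N, 0) (shape_of L) i).1.
Proof. by move=> iL; rewrite (nth_map (t0, 0))// (nth_map (t0, 0)). Qed.

Lemma mem_pos t0 (L : seq (T * rat)) t : t \in unzip1 L ->
  exists2 i, (i < size L)%N & t = nth t0 (unzip1 L) i.
Proof. by move=> /(nthP t0)[i]; rewrite size_map => iL <-; exists i. Qed.

(** A common position carries the same value in both vectors, as it has the same
    rank in both lists. So the late summands fall under [lp_norm_sub_le], and the
    early ones cancel. *)
Lemma same_shape_norm_sub (t0 : T) (y z : Y) L L' (m : nat) (rho : R) :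
  lists_coords y L -> lists_coords z L' -> shape_of L = shape_of L' ->
  (forall i l, (i < size L)%N -> (l < size L)%N ->
    nth t0 (unzip1 L) i = nth t0 (unzip1 L') l -> i = l) ->
  (forall i, (i < size L)%N -> (tag (nth t0 (unzip1 L) i) < m)%N ->
    nth t0 (unzip1 L) i = nth t0 (unzip1 L') i) ->
  0 <= rho -> (forall k, (m <= k)%N -> 2 <= rho `^ q k) ->
  `|y - z| <= rho * `|y|.
Proof.
move=> yL zL' LL' rank low rho0 rho2.
have sz : size L = size L' by have := congr1 size LL'; rewrite !size_map.
have [_ _ yL0] := yL; have [_ _ zL0] := zL'.
have tri t : [\/ entry y t = entry z t, entry y t = 0 | entry z t = 0].
  have [/(mem_pos t0)[i iL ti]|/yL0] := boolP (t \in unzip1 L); last by constructor 2.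
  have [/(mem_pos t0)[l lL tl]|/zL0] := boolP (t \in unzip1 L'); last by constructor 3.
  constructor 1; have il : i = l by apply: (rank _ _ iL); [rewrite sz|rewrite -ti -tl].
  rewrite {1}ti tl (entry_nth t0 yL)// (entry_nth t0 zL')//.
  by rewrite il LL'.
have same t : (tag t < m)%N -> entry y t = entry z t.
  move=> tm; have [/(mem_pos t0)[i iL ti]|tL] := boolP (t \in unzip1 L).
    have e : t = nth t0 (unzip1 L') i by rewrite ti; apply: low; rewrite // -ti.
    by rewrite {1}ti e (entry_nth t0 yL)// (entry_nth t0 zL') -?sz// LL'.
  rewrite yL0//; have [/(mem_pos t0)[l]|/zL0//] := boolP (t \in unzip1 L').
  rewrite -sz => lL tl; case/negP: tL.
  have tagl : tag (nth t0 (unzip1 L) l) = tag t.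
    by rewrite tl (tag_nth t0 lL) (@tag_nth t0 L' l) -?sz// LL'.
  have -> : t = nth t0 (unzip1 L) l by rewrite tl -low// tagl.
  by apply: mem_nth; rewrite size_map.
apply: lp_norm_le_scale => // k; rewrite lpsumB_coord.
have [km|mk] := ltnP k m.
  have -> : y k = z k.
    by apply: (@lpsum_eq _ _ (q1 k)) => g; exact: (same (Tagged H g)).
  by rewrite subrr normr0 mulr_ge0.
pose yk : E k := y k; pose zk : E k := z k.
have tri' g : [\/ yk g = zk g, yk g = 0 | zk g = 0] := tri (Tagged H g).
have eyz : `|yk| = `|zk| := lists_coords_norm k yL zL' LL'.
exact: (lp_norm_sub_le rho0 (rho2 k mk) eyz tri').
Qed.

(** Among many points of a ball some are approximated, relative to the centre, by
    vectors of a common shape, as there are countably many shapes. For two of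
    these that meet the assumptions of the previous lemma, the distance is
    almost bounded by [rho r]. *)
Lemma crowded_ball_pair (U : Type) (B : set U) (t0 : T) (A : set Y) (x : Y)
    (m : nat) (r e rho : R) :
  infinite_set B -> ~ (A #<= B)%card ->
  (forall k, (k < m)%N -> ([set: H k] #<= B)%card) ->
  (forall a, A a -> `|x - a| <= r) -> 0 < e ->
  0 <= rho -> (forall k, (m <= k)%N -> 2 <= rho `^ q k) ->
  exists a b, [/\ A a, A b, a <> b & `|a - b| <= rho * (r + e) + (e + e)].
Proof.
move=> Binf nAB Hsmall Ar e0 rho0 rho2; have BB := card_le_square Binf.
have /choice[f fP] (a : Y) : exists yL : Y * seq (T * rat),
    lists_coords yL.1 yL.2 /\ `|a - x - yL.1| <= e.
  have [y /ratfin_list[L yL] ay] := ratfin_dense (a - x) e0.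
  by exists (y, L).
pose v a := (f a).1; pose L a := (f a).2.
have fL a : lists_coords (v a) (L a) by have [] := fP a.
have fe a : `|a - x - v a| <= e by have [] := fP a.
have [s nAs] : exists s, ~ (A `&` [set a | shape_of (L a) = s] #<= B)%card.
  apply: contrapT => /forallNP h; apply: nAB.
  have -> : A = \bigcup_(s in setT) (A `&` [set a | shape_of (L a) = s]).
    by apply/seteqP; split=> [a Aa|a [s _ []]//]; exists (shape_of (L a)).
  apply: card_le_bigcup => // [|s _]; last exact: contrapT (h s).
  apply: (@card_le_trans _ _ _ [set: nat]); last exact/infiniteP.
  exact: countableP.
have szL a : shape_of (L a) = s -> size (L a) = size s.
  by move=> <-; rewrite size_map.
have := @tuple_pair _ T _ B _ (size s) (fun a i => nth t0 (unzip1 (L a)) i) Binf nAs.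
case.
  move=> a [_ /szL sa] i l /eqP; have [uL _ _] := fL a.
  by rewrite nth_uniq ?size_map ?sa// => /eqP/val_inj.
move=> a [b [[Aa sa] [Ab sb] ab rank low]].
exists a, b; split => //.
have hv : `|v a - v b| <= rho * `|v a|.
  apply: (same_shape_norm_sub (t0 := t0) (L := L a) (L' := L b) (m := m)) => //.
  - by rewrite sa.
  - move=> i l; rewrite (szL _ sa) => iL lL il.
    by have := rank (Ordinal iL) (Ordinal lL) il => -[].
  - move=> i; rewrite (szL _ sa) => iL tm.
    apply: (low (Ordinal iL) [set t | tag t = (nth (0%N, 0) s i).1]).
      have tagi := @tag_nth t0 (L a) i; rewrite (szL _ sa) sa in tagi.
      rewrite (tagi iL) in tm.
      apply: card_le_trans (Hsmall _ tm).
      apply: (@card_le_rel _ _ _ _ (fun t g => t = Tagged H g)) => [[k g] /= kE|].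
        by subst k; exists g.
      by move=> t t' g _ _ -> ->.
    move=> c [_ /= sc]; have := @tag_nth t0 (L c) i.
    by rewrite (szL _ sc) sc; apply.
apply: le_trans (norm_sub_via a b x (v a) (v b)) _.
have hva : `|v a| <= r + e.
  apply: le_trans (norm_le_via a x (v a)) _.
  by apply: lerD; [exact: Ar|exact: fe].
have {}hva := ler_wpM2l rho0 hva; have {hv}hva := le_trans hv hva.
rewrite addrAC [leRHS]addrC; apply: lerD => //.
by apply: lerD; exact: fe.
Qed.

Lemma step_norm_ge (w : Y) m (g : H m) (d : R) :
  entry w (Tagged H g) = 0 ->
  let e : Y := lpsingle p1 m (lpsingle (q1 m) g (d : R^o) : E m) in
  `|w m| `^ q m + `|d| `^ q m <= `|(w + e) m| `^ q m /\ `|w| <= `|w + e|.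
Proof.
move=> wg e; pose wm : E m := w m; pose em : E m := lpsingle (q1 m) g (d : R^o).
have h : `|wm| `^ q m + `|d : R^o| `^ q m <= `|wm + em| `^ q m.
  exact: lp_pow_single_add.
split; first by rewrite lpsum_add_single_in; exact: h.
apply: lp_norm_add_single_ge.
apply: (powR_le_inv (q1 m)) (normr_ge0 _) _; apply: le_trans h.
by rewrite lerDl powR_ge0.
Qed.

(** Otherwise one could walk away from [P]: as only few points of [P] are
    within [r'] of the current position [x], some direction of the [m]-th summand
    is off the supports of all their differences with [x]. A step of length
    [r' - r] in that direction takes no point of [P] closer than [r] that was
    not, and it increases the distance to the others by a fixed amount. *)
Lemma exists_crowded_ball (U : Type) (B : set U) (P : set Y) m (r r' : R) :
  infinite_set B -> ~ ([set: H m] #<= B)%card -> r < r' -> 0 <= r -> r_dense r P ->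
  exists x, ~ (P `&` [set a | (`|x - a| <= r')%R] #<= B)%card.
Proof.
move=> Binf nHB rr' r0 Pd; apply: contrapT => /forallNP h.
have {}h x : (P `&` [set a | (`|x - a| <= r')%R] #<= B)%card := contrapT (h x).
have BB := card_le_square Binf.
pose d := r' - r; have d0 : 0 < d by rewrite subr_gt0.
(* The invariant: a point that is still within [r] has been left behind by each
   of the [n] steps. *)
have walk n : exists x, forall a, P a -> `|x - a| <= r ->
    n%:R * d `^ q m <= `|(x - a) m| `^ q m.
  elim: n => [|n [x IH]].
    by exists 0 => a _ _; rewrite mul0r powR_ge0.
  (* The directions that would interfere with a point near [x]. *)
  pose N := \bigcup_(a in P `&` [set a | (`|x - a| <= r')%R])
     [set g : H m | entry (x - a) (Tagged H g) != 0].
  have NB : (N #<= B)%card.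
    apply: card_le_bigcup (h x) _ => // a _.
    apply: (@card_le_trans _ _ _ [set: nat]); last exact/infiniteP.
    exact: (lp_support_countable ((x - a) m : E m)).
  have [g nNg] : exists g, ~ N g.
    apply: contrapT => /forallNP Ng; apply: nHB; apply: card_le_trans NB.
    by apply: subset_card_le => g _; exact: contrapT (Ng g).
  pose e : Y := lpsingle p1 m (lpsingle (q1 m) g (d : R^o) : E m).
  have ne : `|e| = d by rewrite /e !lp_norm_single; exact: gtr0_norm.
  exists (x + e) => a Pa; rewrite addrAC => xea.
  have xa : `|x - a| <= r'.
    have -> : x - a = (x - a + e) - e by rewrite addrK.
    apply: le_trans (ler_normB _ _) _.
    by rewrite ne -lerBrDr /d subKr.
  have xag : entry (x - a) (Tagged H g) = 0.
    by apply/eqP; apply: contrapT => /negP xag; apply: nNg; exists a.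
  have [st1 st2] := step_norm_ge d xag.
  have IHa := IH a Pa (le_trans st2 xea).
  rewrite -natr1 mulrDl mul1r; apply: le_trans st1.
  by rewrite (gtr0_norm d0) lerD2r.
have dq : 0 < d `^ q m by rewrite powR_gt0.
pose n := Num.bound (r `^ q m / d `^ q m).
have [x xP] := walk n; have [a Pa xa] := Pd x.
have := xP a Pa xa; apply/negP; rewrite -ltNge.
apply: (@le_lt_trans _ _ (r `^ q m)).
  apply: powR_le; [exact: lt_le_trans (q1 m)|exact: normr_ge0|].
  by apply: le_trans xa; exact: lpsum_norm_coord.
by rewrite -ltr_pdivrMr// archi_boundP// divr_ge0// powR_ge0.
Qed.

End LpOfLq.

Lemma gamma_Xspace (R : realType) (q : nat -> R)
    (q1 : forall k, (0 < k)%N -> 1 <= q k) (qoo : q @ \oo --> +oo)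
    (G : nat -> choiceType)
    (cardG : forall k, (0 < k)%N -> has_aleph k [set: G k])
    (p : R) (p1 : 1 <= p) : gamma (Xspace p1 q1 G) = 2.
Proof.
apply: gamma_eq2 => r P r0 Pd Ps; rewrite leNgt; apply/negP => r2.
(* With this [e], [r'] is the midpoint of [r] and [2], and
   [rho * (r' + e) + 2 * e < 2]. *)
pose e := (2 - r) / 16; have e0 : 0 < e by rewrite divr_gt0// subr_gt0.
pose rho := 1 + e; pose r' := 2 - 8 * e.
have rr' : r < r' by rewrite /r' /e; lra.
have rho1 : 1 < rho by rewrite ltrDl.
have lnrho : 0 < ln rho by rewrite ln_gt0.
have [m _ qm] : \forall n \near \oo, (ln rho)^-1 <= q n.
  by move/cvgryPge : qoo; apply.
(* From [rho^q >= 1 + q ln rho]. *)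
have rho2 k : (m <= k)%N -> 2 <= rho `^ q k.+1.
  move=> mk; rewrite /powR gt_eqF ?(lt_trans _ rho1)//.
  apply: le_trans (expR_ge1Dx _); rewrite -[leLHS](natrD _ 1 1) lerD2l.
  by rewrite -ler_pdivrMr// div1r; apply: qm => /=; exact: leqW.
(* [B] has cardinal aleph_m: the summand over [G m.+1] is larger, and all
   earlier ones are over index sets at most as large. *)
have [B [_ Baleph nGB _]] := cardG m.+1 isT.
have Binf := has_aleph_infinite Baleph.
have small k : (k < m)%N -> ([set: G k.+1] #<= B)%card.
  by move=> km; apply: has_aleph_le Baleph; [exact: km|exact: cardG].
have [x nx] := exists_crowded_ball (H := fun k => G k.+1) Binf nGB rr' (ltW r0) Pd.
have [g _] := infinite_setN0 (has_aleph_infinite (cardG 1%N isT)).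
have near_x a : (P `&` [set a | (`|x - a| <= r')%R]) a -> `|x - a| <= r' by case.
have [a [b [[Pa _] [Pb _] ab abr]]] :=
  crowded_ball_pair (Tagged (fun k => G k.+1) (g : (fun k => G k.+1) 0%N))
    Binf nx small near_x e0 (ltW (lt_trans ltr01 rho1)) rho2.
have := le_trans (Ps a b Pa Pb ab) abr; rewrite /rho /r' => h.
have : 0 <= e * e by rewrite mulr_ge0 ?ltW.
clear -h e0.
nra.
Qed.

(** * Octahedrality *)

(** For a coordinate [yk] of a vector at distance [yu] from one with a small
    coordinate [uk]. *)
Lemma perturbed_bound (R : realType) (e h t y u yu yk uk : R) : 0 < e ->
  yk <= uk + yu -> uk <= e * u -> u <= y + yu -> yu <= t -> (e + 1) * t <= h ->
  yk <= e * y + h.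
Proof.
move=> e0 h1 h2 h3 h4 h5.
have h6 : e * u <= e * (y + t) by rewrite ler_pM2l//; lra.
have : e * (y + t) = e * y + e * t by rewrite mulrDr.
move: h5; rewrite mulrDl mul1r; lra.
Qed.

(** [s] is the norm of the coordinate that is removed from [z] to obtain [w]. *)
Lemma octahedral_bound (R : realType) (e z l l' w s zl wl : R) :
  0 < e -> 0 <= l -> l' = l ->
  s <= e / 2 * z -> z <= w + s -> wl <= zl + s -> w `^ 1 + l' `^ 1 <= wl `^ 1 ->
  0 <= w -> 0 <= wl ->
  (1 - e) * (z + l) <= zl.
Proof.
move=> e0 l0 -> h1 h2 h3 + w0 wl0; rewrite !powRr1// => h4.
have h5 : 0 <= e * l by rewrite mulr_ge0// ltW.
have : e / 2 * z + e / 2 * z = e * z by rewrite -mulrDl -splitr.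
by rewrite mulrDr !mulrBl !mul1r; lra.
Qed.

(** For a vector [z + a v] of norm [y], where [v] is at distance [d] from the
    possible [z]. *)
Lemma separated_bound (R : realType) (e d a v y z yk zk vk : R) :
  0 < e -> 0 < d -> 0 <= a -> 0 <= v -> a * d <= y -> z <= y + a * v ->
  yk <= zk + a * vk -> zk <= e / 2 / (1 + v / d) * z -> vk <= e / 2 * d ->
  yk <= e * y.
Proof.
move=> e0 d0 a0 v0 ad zy h hz hv; set c := 1 + v / d in hz.
have c0 : 0 < c by rewrite ltr_pwDl// divr_ge0// ltW.
have ay : a <= y / d by rewrite ler_pdivlMr.
have {}zy : z <= c * y.
  apply: le_trans zy _; rewrite mulrDl mul1r lerD2l.
  by rewrite [leRHS](_ : _ = y / d * v) ?ler_wpM2r//; ring.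
have e1 : 0 < e / 2 / c by rewrite !divr_gt0.
have {}hz : zk <= e / 2 * y.
  apply: le_trans hz _; rewrite [leRHS](_ : _ = e / 2 / c * (c * y)) ?ler_pM2l//.
  by field; rewrite gt_eqF.
have {}hv : a * vk <= e / 2 * y.
  apply: le_trans (ler_wpM2l a0 hv) _.
  rewrite mulrCA; apply: ler_wpM2l => //; by rewrite divr_ge0 ?ltW.
apply: le_trans h _; rewrite [e in leRHS]splitr mulrDl; exact: lerD.
Qed.

Section UniformTail.
Context (R : realType) (p : R) (p1 : 1 <= p) (X : nat -> completeNormedModType R).
Local Notation V := (lpsum p1 X).

Definition uniform_tail (Z : set V) := forall e, 0 < e ->
  exists N, forall k z, (N <= k)%N -> Z z -> `|z k| <= e * `|z|.

Lemma lpsum_coord_tail (x : V) (e : R) : 0 < e ->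
  exists N, forall k, (N <= k)%N -> `|x k| <= e.
Proof.
move=> /(lp_tail x)[F xF]; exists (\max_(i <- F) i).+1 => k Fk.
have kF : k \notin F.
  apply/negP => kF; move: Fk; rewrite ltnNge => /negP; apply.
  exact: leq_bigmax_seq.
apply: le_trans xF; have := lpsum_norm_coord (x - lprestr (mem F) x) k.
by rewrite lp_sub_restrE (_ : mem F k = (k \in F))// (negbTE kF).
Qed.

Lemma norm_coord_via (y z : V) k : `|y k| <= `|z k| + `|y - z|.
Proof.
have -> : y k = z k + (y - z) k by rewrite lpsumB_coord addrC subrK.
by apply: le_trans (ler_normD _ _) _; rewrite lerD2l; exact: lpsum_norm_coord.
Qed.

Lemma norm_via (y z : V) : `|z| <= `|y| + `|y - z|.
Proof. by rewrite -lerBlDl; apply: le_trans (lerB_dist _ _) _; rewrite distrC. Qed.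

(** A vector [v] at distance [0] from [Z] adds only limits of elements of [Z],
    for which the same bound holds. If the distance is [d > 0] then
    [|a| <= |z + a v| / d], so [|z|] and [|a v|] are controlled by [|z + a v|]. *)
Lemma uniform_tail_add_line (Z : set V) (v : V) :
  (forall z w (a : R), Z z -> Z w -> Z (z + a *: w)) -> Z 0 -> uniform_tail Z ->
  uniform_tail [set y | exists2 z, Z z & exists a : R, y = z + a *: v].
Proof.
move=> Zlin Z0 Ztail e e0.
have [close|] := pselect (forall d, 0 < d -> exists2 w, Z w & `|v - w| <= d).
  have [N NP] := Ztail e e0; exists N => k _ Nk [z Zz [a ->]]; set y := z + _.
  apply/ler_addgt0Pr => h h0; pose c := (e + 1) * (`|a| + 1).
  have c0 : 0 < c by rewrite mulr_gt0// ltr_wpDl// ltW.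
  have [w Zw vw] := close (h / c) (divr_gt0 h0 c0).
  have Zzw := Zlin z w a Zz Zw; set u := z + a *: w in Zzw.
  have yu : `|y - u| <= `|a| * (h / c).
    have -> : y - u = a *: (v - w) by rewrite /y /u opprD addrACA subrr add0r scalerBr.
    by rewrite normrZ ler_wpM2l.
  apply: (perturbed_bound e0 (norm_coord_via y u k) (NP k u Nk Zzw) (norm_via y u) yu).
  rewrite !mulrA ler_pdivrMr// [leLHS](_ : _ = (e + 1) * `|a| * h); last by ring.
  rewrite [leRHS]mulrC /c ler_pM2r// ler_pM2l ?lerDl// addr_gt0//.
move=> /existsNP[d /not_implyP[d0 far]].
have {}far z (a : R) : Z z -> `|a| * d <= `|z + a *: v|.
  move=> Zz; have [->|a0] := eqVneq a 0; first by rewrite normr0 mul0r.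
  have -> : z + a *: v = a *: (v - (- a^-1) *: z).
    by rewrite scalerBr scalerA mulrN mulfV// scaleN1r opprK addrC.
  rewrite normrZ ler_wpM2l// ltW// ltNge; apply/negP => h; apply: far.
  by exists (- a^-1 *: z) => //; rewrite -[X in Z X]add0r; exact: Zlin.
have e1 : 0 < e / 2 / (1 + `|v| / d) by rewrite !divr_gt0// ltr_pwDl// divr_ge0// ltW.
have e2 : 0 < e / 2 * d by rewrite mulr_gt0// divr_gt0.
have [N NP] := Ztail _ e1; have [M MP] := lpsum_coord_tail v e2.
exists (maxn N M) => k _ + [z Zz [a ->]]; rewrite geq_max => /andP[Nk Mk].
have zy : `|z| <= `|z + a *: v| + `|a| * `|v|.
  by have := norm_via (z + a *: v) z; rewrite [z + _ - z]addrAC subrr add0r normrZ.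
have yk : `|(z + a *: v) k| <= `|z k| + `|a| * `|v k|.
  by rewrite -normrZ; exact: ler_normD.
exact: separated_bound e0 d0 (normr_ge0 a) (normr_ge0 v) (far z a Zz) zy yk
  (NP k z Nk Zz) (MP k Mk).
Qed.

Lemma finite_dim_uniform_tail (Z : set V) : finite_dim_subspace Z -> uniform_tail Z.
Proof.
move=> [n [e ->]]; elim: n e => [|n IH] e.
  move=> d d0; exists 0%N => k _ _ [a _ <-].
  by rewrite big_ord0 !normr0 mulr0.
pose e' i := e (widen_ord (leqnSn n) i).
set W := [set _ | _ in _]; pose W' := [set \sum_(i < n) a i *: e' i | a in [set: 'I_n -> R]].
suff WW' : W `<=` [set y | exists2 z, W' z & exists a : R, y = z + a *: e ord_max].
  have tl : uniform_tail [set y | exists2 z, W' z & exists a : R, y = z + a *: e ord_max].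
    apply: uniform_tail_add_line; last exact: IH.
      move=> _ _ a [b _ <-] [c _ <-]; exists (fun i => b i + a * c i) => //.
      rewrite scaler_sumr -big_split/=; apply: eq_bigr => i _.
      by rewrite scalerDl scalerA.
    by exists (fun=> 0) => //; rewrite big1// => i _; rewrite scale0r.
  move=> d /tl[N NP]; exists N => k z Nk /WW'; exact: NP.
move=> _ [a _ <-]; exists (\sum_(i < n) a (widen_ord (leqnSn n) i) *: e' i).
  by exists (fun i => a (widen_ord (leqnSn n) i)).
by exists (a ord_max); rewrite big_ord_recr.
Qed.

End UniformTail.

(** A unit vector of a late summand is almost disjoint from all of [Z]: replacing
    [z] by [z] without its [n]-th coordinate changes norms by at most
    [e/2 |z|], and then norms add up exactly, as the exponent is [1]. *)
Lemma l1sum_octahedral (R : realType) (X : nat -> completeNormedModType R) :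
  (forall n, exists u : X n, `|u| = 1) -> octahedral (lpsum (lexx (1 : R)) X).
Proof.
move=> unitX Z Zfin e e0; have e2 : 0 < e / 2 by rewrite divr_gt0.
have [n nP] := finite_dim_uniform_tail Zfin e2; have [u u1] := unitX n.
exists (lpsingle _ n u) => [|z Zz l]; first by rewrite lp_norm_single.
pose w := z - lpsingle _ n (z n).
have wn : w n = 0 by rewrite /w lpsumB_coord lpsingle_in subrr.
have := lp_pow_single_add (l *: u) wn.
rewrite linearZ => h1.
have lu : `|l *: u| = `|l| by rewrite normrZ u1 mulr1.
have zn : `|lpsingle (lexx (1 : R)) n (z n)| <= e / 2 * `|z|.
  by rewrite lp_norm_single; exact: nP.
have h2 : `|z| <= `|w| + `|lpsingle (lexx (1 : R)) n (z n)|.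
  by rewrite -[X in `|X| <= _](subrK (lpsingle (lexx (1 : R)) n (z n))); exact: ler_normD.
have h3 : `|w + l *: lpsingle (lexx (1 : R)) n u| <=
    `|z + l *: lpsingle (lexx (1 : R)) n u| + `|lpsingle (lexx (1 : R)) n (z n)|.
  by rewrite /w addrAC; exact: ler_normB.
exact: (octahedral_bound e0 (normr_ge0 l) lu zn h2 h3 h1 (normr_ge0 _) (normr_ge0 _)).
Qed.

(** * Reflexivity *)

Section DualTools.
Context (R : realType) (V : normedModType R).

Lemma dual_norm_le_bound (f : dual V) (C : R) : 0 <= C ->
  (forall x, `|f x| <= C * `|x|) -> `|f| <= C.
Proof.
move=> C0 fC; rewrite dual_normE; apply: ge_sup.
  by exists `|f 0|, 0 => //=; rewrite normr0.
move=> _ [x /= x1 <-]; apply: le_trans (fC x) _.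
by rewrite ler_piMr.
Qed.

Lemma bounded_functional_continuous (f : V -> R^o) (C : R) : linear f ->
  (forall x, `|f x| <= C * `|x|) -> continuous f.
Proof.
move=> flin fC x; apply/cvgrPdist_le => e e0.
have C1 : 0 < `|C| + 1 by rewrite ltr_wpDl.
apply/nbhs_ballP; exists (e / (`|C| + 1)) => /=; first by rewrite divr_gt0.
move=> y; rewrite -ball_normE/= => /ltW xy.
have -> : f x - f y = f (x - y).
  by rewrite addrC -scaleN1r -flin addrC scaleN1r.
apply: le_trans (fC _) _; apply: (@le_trans _ _ ((`|C| + 1) * `|x - y|)).
  by rewrite ler_wpM2r// (le_trans (ler_norm C))// lerDl.
by rewrite -ler_pdivlMl// mulrC.
Qed.

Definition bounded_dual (f : V -> R^o) (C : R) (flin : linear f)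
    (fC : forall x, `|f x| <= C * `|x|) : dual V :=
  Dual flin (bounded_functional_continuous flin fC).

Lemma dual_is_linear (f : dual V) : linear (f : V -> R^o).
Proof. exact: dual_linear. Qed.

HB.instance Definition _ (f : dual V) :=
  GRing.isLinear.Build R V R^o _ (f : V -> R^o) (dual_is_linear f).

Lemma dual_sum_coord (J : Type) (s : seq J) (f : J -> dual V) x :
  (\sum_(j <- s) f j) x = \sum_(j <- s) f j x.
Proof. by elim: s => [|j s IH]; rewrite ?big_nil// !big_cons dualD_coord IH. Qed.

Lemma dual_sum (J : Type) (s : seq J) (f : dual V) (x : J -> V) :
  f (\sum_(j <- s) x j) = \sum_(j <- s) f (x j).
Proof. exact: (linear_sum (f : {linear V -> R^o})). Qed.

Lemma dualB (f : dual V) x y : f (x - y) = f x - f y.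
Proof. exact: (linearB (f : {linear V -> R^o})). Qed.

Lemma dualD (f : dual V) x y : f (x + y) = f x + f y.
Proof. exact: (linearD (f : {linear V -> R^o})). Qed.

End DualTools.

Section Scalars.
Context (R : realType) (p : R) (p1 : 1 <= p).

Lemma powR_pred (s : R) : 0 <= s -> s `^ p = s `^ (p - 1) * s.
Proof.
rewrite le_eqVlt => /predU1P[<-|s0]; first by rewrite mulr0 powR0// gt_eqF// (lt_le_trans ltr01).
by rewrite -[X in _ * X]powRr1 ?ltW// -powRD ?subrK// (gt_eqF s0) implybT.
Qed.

(** Up to the constant this is Young's inequality. *)
Lemma powR_pred_mul_le (a b : R) : 0 <= a -> 0 <= b ->
  a `^ (p - 1) * b <= a `^ p + b `^ p.
Proof.
move=> a0 b0; have [ba|/ltW ab] := leP b a.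
  by rewrite (powR_pred a0) ler_wpDr ?powR_ge0// ler_wpM2l ?powR_ge0.
rewrite (powR_pred b0) ler_wpDl ?powR_ge0// ler_wpM2r//.
by apply: ge0_ler_powR; rewrite ?nnegrE ?subr_ge0.
Qed.

(** Hoelder's inequality for the exponents [p / (p - 1)] and [p], up to a factor
    [2]: after normalization every term is bounded by the previous lemma. *)
Lemma holder_up_to_2 (I : Type) (F : seq I) (s t : I -> R) (M N : R) :
  0 < M -> 0 < N -> (forall i, 0 <= s i) -> (forall i, 0 <= t i) ->
  \sum_(i <- F) s i `^ p <= M `^ p -> \sum_(i <- F) t i `^ p <= N `^ p ->
  \sum_(i <- F) s i `^ (p - 1) * t i <= 2 * M `^ (p - 1) * N.
Proof.
move=> M0 N0 s0 t0 sM tN.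
have hM : 0 < M `^ (p - 1) by rewrite powR_gt0.
have le1 (a : I -> R) K : 0 < K -> (forall i, 0 <= a i) ->
    \sum_(i <- F) a i `^ p <= K `^ p -> \sum_(i <- F) (a i / K) `^ p <= 1.
  move=> K0 a0 aK.
  have -> : \sum_(i <- F) (a i / K) `^ p = (\sum_(i <- F) a i `^ p) * K^-1 `^ p.
    by rewrite mulr_suml; apply: eq_bigr => i _; rewrite powRM// invr_ge0 ltW.
  apply: (@le_trans _ _ (K `^ p * K^-1 `^ p)); first by rewrite ler_wpM2r ?powR_ge0.
  have Kge := ltW K0; rewrite -powRM ?invr_ge0// divff ?gt_eqF//; by rewrite powR1.
have -> : \sum_(i <- F) s i `^ (p - 1) * t i =
    M `^ (p - 1) * N * \sum_(i <- F) (s i / M) `^ (p - 1) * (t i / N).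
  rewrite mulr_sumr; apply: eq_bigr => i _.
  have si : M `^ (p - 1) * (s i / M) `^ (p - 1) = s i `^ (p - 1).
    by rewrite -powRM ?(ltW M0) ?divr_ge0 ?(ltW M0)// mulrC divfK// gt_eqF.
  by rewrite mulrACA si [N * _]mulrC divfK ?gt_eqF.
rewrite -[leRHS]mulrA [leRHS]mulrC ler_pM2l ?mulr_gt0//.
apply: (@le_trans _ _ (\sum_(i <- F) ((s i / M) `^ p + (t i / N) `^ p))).
  by apply: ler_sum => i _; apply: powR_pred_mul_le; rewrite divr_ge0// ltW.
by rewrite big_split/= -[2]/(1 + 1) lerD// le1.
Qed.

End Scalars.

(** Functionals that norm a vector up to a constant can be written down
    explicitly in l_p-sums, which avoids any extension theorem. It matters that
    the constant [c] can be chosen uniformly over the summands. *)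
Definition norming (R : realType) (V : normedModType R) (c : R) :=
  forall x : V, exists2 f : dual V, `|f| <= 1 & c * `|x| <= f x.

(** This is [n d <= C n^(1/p)] for all [n], with [a] in place of [n^(1/p)]. *)
Lemma linear_growth_absurd (R : realType) (p d C : R) : 1 < p -> 0 < d -> 0 <= C ->
  ~ forall n, exists a : R, [/\ 0 <= a, a `^ p <= n%:R & n%:R * d <= C * a].
Proof.
move=> p1 d0 C0 h; have p0 : 0 < p := lt_trans ltr01 p1.
have q0 : 0 < p - 1 by rewrite subr_gt0.
pose K := (C / d) `^ p; have K0 : 0 <= K := powR_ge0 _ _.
pose n := (Num.bound (K `^ (p - 1)^-1)).+1; have n0 : 0 < n%:R :> R by rewrite ltr0n.
have Kn : K < n%:R `^ (p - 1).
  have e1 : K = (K `^ (p - 1)^-1) `^ (p - 1).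
    by rewrite -powRrM mulVf ?powRr1// gt_eqF.
  rewrite {1}e1; apply: gt0_ltr_powR; rewrite ?nnegrE ?powR_ge0//.
  apply: lt_trans (archi_boundP (powR_ge0 _ _)) _; by rewrite ltr_nat.
have [a [a0 an dn]] := h n.
have na : n%:R <= C / d * a by rewrite mulrAC ler_pdivlMr.
have : n%:R `^ p <= K * n%:R.
  apply: le_trans (powR_le p0 (ltW n0) na) _.
  by rewrite powRM ?divr_ge0 ?(ltW d0)// ler_wpM2l.
by rewrite (powR_pred (ltW p1) (ltW n0)) ler_pM2r// leNgt Kn.
Qed.

Lemma lt_of_sub_lt (R : realDomainType) (a b c e : R) :
  e < a - b -> a <= e + c -> b < c.
Proof. by lra. Qed.

Section DualLpSum.
Context (R : realType) (p : R) (p1 : 1 <= p) (I : choiceType).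
Context (X : I -> completeNormedModType R).
Local Notation V := (lpsum p1 X).

Let p0 : 0 < p. Proof. exact: lt_le_trans p1. Qed.

Lemma proj_dual_linear i (g : dual (X i)) : linear ((fun y : V => g (y i)) : V -> R^o).
Proof. by move=> a x y; rewrite lpsumD_coord lpsumZ_coord; exact: dual_linear. Qed.

Lemma proj_dual_bound i (g : dual (X i)) (y : V) : `|g (y i)| <= `|g| * `|y|.
Proof.
apply: le_trans (dual_norm_le g (y i)) _.
by apply: ler_wpM2l; [exact: dual_norm_ge0|exact: lpsum_norm_coord].
Qed.

Definition proj_dual i (g : dual (X i)) : dual V :=
  bounded_dual (proj_dual_linear g) (proj_dual_bound g).

Lemma proj_dualE i (g : dual (X i)) (y : V) : proj_dual g y = g (y i).
Proof. by []. Qed.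

Lemma single_dual_linear i (f : dual V) :
  linear ((fun v : X i => f (lpsingle p1 i v)) : X i -> R^o).
Proof. by move=> a x y; rewrite linearP; exact: dual_linear. Qed.

Lemma single_dual_bound i (f : dual V) (v : X i) :
  `|f (lpsingle p1 i v)| <= `|f| * `|v|.
Proof.
by apply: le_trans (dual_norm_le f _) _; rewrite lp_norm_single.
Qed.

Definition single_dual i (f : dual V) : dual (X i) :=
  bounded_dual (single_dual_linear f) (@single_dual_bound i f).

(** The functionals that are extremal in Hoelder's inequality for [x], restricted
    to the coordinates in [F]. *)
Lemma norming_finite_sum (c : R) (x : forall i, X i) (F : {fset I}) (M : R) :
  0 <= c -> (forall i, norming (X i) c) -> 0 < M -> \sum_(i <- F) `|x i| `^ p = M `^ p ->
  exists2 f : forall i, dual (X i), forall i, c * `|x i| <= f i (x i) &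
    `|\sum_(i <- F) `|x i| `^ (p - 1) *: proj_dual (f i)| <= 2 * M `^ (p - 1).
Proof.
move=> c0 Xc M0 xM.
have fex i : exists f : dual (X i), `|f| <= 1 /\ c * `|x i| <= f (x i).
  by have [f f1 fx] := Xc i (x i); exists f.
pose f i := projT1 (cid (fex i)).
have f1 i : `|f i| <= 1 by rewrite /f; case: (cid _) => g [].
have fx i : c * `|x i| <= f i (x i) by rewrite /f; case: (cid _) => g [].
exists f => //; apply: dual_norm_le_bound; first by rewrite mulr_ge0 ?powR_ge0.
move=> y; have [->|y0] := eqVneq y 0.
  by rewrite linear0 !normr0 mulr0.
have ny0 : 0 < `|y| by rewrite normr_gt0.
have xM' : \sum_(i <- F) `|x i| `^ p <= M `^ p by rewrite xM.
have := holder_up_to_2 p1 M0 ny0 (fun i => normr_ge0 (x i))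
  (fun i => normr_ge0 (y i)) xM' (lp_sum_pow_le y F).
apply: le_trans.
rewrite dual_sum_coord; apply: le_trans (ler_norm_sum _ _ _) _; apply: ler_sum => i _.
rewrite dualZ_coord proj_dualE normrM ger0_norm ?powR_ge0//.
rewrite ler_wpM2l ?powR_ge0//; apply: le_trans (dual_norm_le _ _) _.
by apply: ler_piMl => //; exact: f1.
Qed.

Lemma powR_dual_value (c : R) (x : forall i, X i) (f : forall i, dual (X i)) (F : seq I) :
  (forall i, c * `|x i| <= f i (x i)) ->
  c * \sum_(i <- F) `|x i| `^ p <= \sum_(i <- F) `|x i| `^ (p - 1) * f i (x i).
Proof.
move=> fx; rewrite mulr_sumr; apply: ler_sum => i _.
by rewrite (powR_pred p1)// mulrCA ler_wpM2l ?powR_ge0.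
Qed.

Lemma lpsum_norming (c : R) : 0 <= c -> (forall i, norming (X i) c) -> norming V (c / 4).
Proof.
move=> c0 Xc x; have [->|x0] := eqVneq x 0.
  by exists 0; [rewrite normr0|rewrite normr0 mulr0].
have nx0 : 0 < `|x| by rewrite normr_gt0.
have [F xF] : exists F : {fset I}, (`|x| / 2) `^ p < \sum_(i <- F) `|x i| `^ p.
  apply: contrapT => /forallNP h.
  have : `|x| <= `|x| / 2.
    apply/(@lpnorm_leP _ _ p1); first by rewrite divr_ge0.
    by move=> F; rewrite leNgt; apply/negP; exact: h.
  by rewrite ler_pdivlMr// ger_pMr// leNgt ltr1n.
pose S := \sum_(i <- F) `|x i| `^ p; pose M := S `^ p^-1.
have S0 : 0 < S by apply: le_lt_trans xF; exact: powR_ge0.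
have M0 : 0 < M by rewrite powR_gt0.
have SM : S = M `^ p by rewrite /M -powRrM mulVf ?gt_eqF// powRr1// ltW.
have xM : `|x| / 2 <= M by apply: (powR_le_inv p1) (ltW M0) _; rewrite -SM ltW.
have [f fx fM] := norming_finite_sum c0 Xc M0 SM.
have K0 : 0 < 2 * M `^ (p - 1) by rewrite mulr_gt0// powR_gt0.
exists ((2 * M `^ (p - 1))^-1 *: \sum_(i <- F) `|x i| `^ (p - 1) *: proj_dual (f i)).
  by rewrite normrZ gtr0_norm ?invr_gt0// ler_pdivrMl// mulr1.
rewrite dualZ_coord dual_sum_coord ler_pdivlMl//.
apply: le_trans (powR_dual_value F fx).
rewrite -/S SM (powR_pred p1 (ltW M0)).
have -> : 2 * M `^ (p - 1) * (c / 4 * `|x|) = c * (M `^ (p - 1) * (`|x| / 2)) by field.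
by rewrite ler_wpM2l// ler_pM2l// powR_gt0.
Qed.

(** Otherwise there would be, for every [n], disjointly supported unit vectors
    [y_1, ..., y_n] with [f y_j > d], so that [n d <= |f| n^(1/p)]. *)
Lemma dual_tail (f : dual V) (d : R) : 1 < p -> 0 < d ->
  exists F : {fset I}, forall y : V, (forall i, i \in F -> y i = 0) ->
    `|f y| <= d * `|y|.
Proof.
move=> p_gt1 d0; apply: contrapT => /forallNP h.
(* The failure for [F] has a witness of finite support, up to normalization. *)
have block (F : {fset I}) : exists F' : {fset I}, exists y : V,
    [/\ forall i, i \in F -> y i = 0, forall i, i \notin F' -> y i = 0,
        `|y| <= 1 & d <= f y].
  have /existsNP[y /not_implyP[yF /negP]] := h F; rewrite -ltNge => dy.
  have f1 : 0 < `|f| + 1 by rewrite ltr_wpDl.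
  have eta : 0 < (`|f y| - d * `|y|) / (`|f| + 1) by rewrite divr_gt0// subr_gt0.
  have [F' yF'] := lp_tail y eta; pose u := lprestr (mem F') y.
  have fyu : `|f (y - u)| < `|f y| - d * `|y|.
    apply: le_lt_trans (dual_norm_le f _) _.
    apply: le_lt_trans (ler_wpM2l (dual_norm_ge0 f) yF') _.
    rewrite mulrCA gtr_pMr ?subr_gt0//.
    by rewrite ltr_pdivrMr// mul1r ltrDl.
  have du : d * `|u| < `|f u|.
    have nu : `|u| <= `|y| := lp_norm_restr (mem F') y.
    apply: le_lt_trans (ler_wpM2l (ltW d0) nu) _; apply: (lt_of_sub_lt fyu).
    by have := ler_normD (f (y - u)) (f u); rewrite -dualD subrK.
  have fu0 : f u != 0.
    by rewrite -normr_gt0; apply: le_lt_trans du; rewrite mulr_ge0// ltW.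
  have nu0 : 0 < `|u|.
    by rewrite normr_gt0; apply: contraNneq fu0 => ->; rewrite linear0.
  exists F', ((Num.sg (f u) / `|u|) *: u); split.
  - by move=> i iF; rewrite lpsumZ_coord lprestrE yF// if_same scaler0.
  - move=> i iF'; rewrite lpsumZ_coord lprestrE (_ : mem F' i = (i \in F'))//.
    by rewrite (negbTE iF') scaler0.
  - rewrite normrZ normrM normfV normr_id normr_sg fu0 mul1r mulVf//.
    by rewrite gt_eqF.
  - rewrite dualZ mulrAC -normrEsg ler_pdivlMr//; exact: ltW.
have chain n : exists F : {fset I}, exists u : V,
    [/\ forall i, i \notin F -> u i = 0, `|u| `^ p <= n%:R & n%:R * d <= f u].
  elim: n => [|n [F [u [uF un fu]]]].
    exists fset0, 0; split => //; last by rewrite linear0 mul0r.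
    by rewrite normr0 powR0// gt_eqF.
  have [F' [y [yF yF' y1 fy]]] := block F.
  exists (F `|` F')%fset, (u + y); split.
  - by move=> i; rewrite inE negb_or => /andP[iF iF']; rewrite lpsumD_coord uF// yF'// addr0.
  - have uy : `|u + y| `^ p <= `|u| `^ p + `|y| `^ p.
      apply: lp_pow_le_add => i; rewrite lpsumD_coord.
      have [iF|iF] := boolP (i \in F).
        by rewrite yF// addr0 lerDl powR_ge0.
      by rewrite uF// add0r lerDr powR_ge0.
    apply: le_trans uy _; rewrite -natr1; apply: lerD => //.
    by apply: le_trans (powR_le p0 (normr_ge0 y) y1) _; rewrite powR1.
  - by rewrite dualD -natr1 mulrDl mul1r; exact: lerD.
apply: (linear_growth_absurd p_gt1 d0 (dual_norm_ge0 f)) => n.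
have [F [u [_ un fu]]] := chain n; exists `|u|; split => //.
by apply: le_trans fu _; apply: le_trans (ler_norm _) (dual_norm_le f u).
Qed.


Lemma proj_dual_norm i (g : dual (X i)) : `|proj_dual g| <= `|g|.
Proof. by apply: dual_norm_le_bound; [exact: normr_ge0|exact: proj_dual_bound]. Qed.

Lemma bidual_coord_linear i (phi : dual (dual V)) :
  linear ((fun g : dual (X i) => phi (proj_dual g)) : dual (X i) -> R^o).
Proof.
move=> a g h; rewrite (_ : proj_dual _ = a *: proj_dual g + proj_dual h).
  exact: dual_linear.
by apply: dual_eq.
Qed.

Lemma bidual_coord_bound i (phi : dual (dual V)) (g : dual (X i)) :
  `|phi (proj_dual g)| <= `|phi| * `|g|.
Proof.
apply: le_trans (dual_norm_le phi _) _.
by apply: ler_wpM2l; [exact: dual_norm_ge0|exact: proj_dual_norm].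
Qed.

(** A functional [phi] of the bidual acts on the dual of each summand, hence
    defines a point [x i] there. Its values at the extremal functionals bound the
    energy of [x], and it agrees with [x] on functionals that depend on finitely
    many coordinates, which are dense in the dual. *)
Lemma lpsum_reflexive (c : R) : 1 < p -> 0 < c -> (forall i, norming (X i) c) ->
  (forall i, reflexive_space (X i)) -> reflexive_space V.
Proof.
move=> p_gt1 c0 Xc Xrefl phi.
have xex i : exists v : X i, forall g : dual (X i), phi (proj_dual g) = g v.
  have [v vE] := Xrefl i (bounded_dual (@bidual_coord_linear i phi) (@bidual_coord_bound i phi)).
  by exists v => g; have := congr1 (fun F : dual (dual (X i)) => F g) vE.
pose xs i := projT1 (cid (xex i)).
have xsE i (g : dual (X i)) : phi (proj_dual g) = g (xs i).
  by rewrite /xs; case: (cid _) => v; apply.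
have xs_fin : (lpenergy p xs < +oo)%E.
  apply: (@lpfin _ _ _ _ _ ((2 * `|phi| / c) `^ p)) => F.
  pose S := \sum_(i <- F) `|xs i| `^ p; pose M := S `^ p^-1.
  have S0 : 0 <= S by apply: sumr_ge0 => i _; exact: powR_ge0.
  have SM : S = M `^ p by rewrite /M -powRrM mulVf ?gt_eqF// powRr1.
  have [M0|M0] := leP M 0.
    rewrite -/S SM (_ : M = 0) ?powR0 ?powR_ge0 ?gt_eqF//.
    by apply/eqP; rewrite eq_le M0 powR_ge0.
  have [f fx fM] := norming_finite_sum (ltW c0) Xc M0 SM.
  have h1 := powR_dual_value F fx; rewrite -/S SM in h1.
  have h2 : phi (\sum_(i <- F) `|xs i| `^ (p - 1) *: proj_dual (f i)) =
      \sum_(i <- F) `|xs i| `^ (p - 1) * f i (xs i).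
    by rewrite dual_sum; apply: eq_bigr => i _; rewrite dualZ xsE.
  have h3 : c * M `^ p <= `|phi| * (2 * M `^ (p - 1)).
    apply: le_trans h1 _; rewrite -h2; apply: le_trans (ler_norm _) _.
    apply: le_trans (dual_norm_le phi _) _; apply: ler_wpM2l fM; exact: dual_norm_ge0.
  rewrite -/S SM; apply: powR_le p0 (ltW M0) _.
  rewrite ler_pdivlMr// -(ler_pM2l (powR_gt0 (p - 1) M0)).
  move: h3; rewrite (powR_pred p1 (ltW M0)).
  by rewrite (mulrCA c) (mulrC c M) (mulrA `|phi|) (mulrC (`|phi| * 2)) (mulrC `|phi| 2).
exists (LpSum p1 xs_fin : V); set x : V := LpSum p1 xs_fin.
apply: dual_eq => f /=; apply/eqP; rewrite -subr_eq0 -normr_le0.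
apply/ler_addgt0Pr => e e0; rewrite add0r.
pose C := `|x| + `|phi| + 1.
have C0 : 0 < C by rewrite ltr_wpDl// addr_ge0//; exact: dual_norm_ge0.
have [F FP] := dual_tail f p_gt1 (divr_gt0 e0 C0).
have xF i : i \in F -> forall y : V, (y - lprestr (mem F) y) i = 0.
  by move=> iF y; rewrite lp_sub_restrE (_ : mem F i = (i \in F))// iF.
have yF (y : V) : `|f (y - lprestr (mem F) y)| <= e / C * `|y|.
  apply: le_trans (FP _ _) _ => [i iF|]; first exact: xF.
  apply: (ler_wpM2l (ltW (divr_gt0 e0 C0))); apply: lp_norm_le => i.
  by rewrite lp_sub_restrE; case: ifP => _ //; rewrite normr0.
(* [g] is [f] composed with the truncation to [F]. *)
pose g : dual V := \sum_(i <- F) proj_dual (single_dual i f).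
have gE (y : V) : g y = f (lprestr (mem F) y).
  by rewrite dual_sum_coord lprestr_sum dual_sum; apply: eq_bigr.
have fg : `|f - g| <= e / C.
  apply: dual_norm_le_bound => [|y]; first by rewrite ltW// divr_gt0.
  rewrite (_ : (f - g) y = f (y - lprestr (mem F) y))//.
  by rewrite dualB -gE.
have phig : phi g = f (lprestr (mem F) x).
  by rewrite dual_sum lprestr_sum dual_sum; apply: eq_bigr => i _; exact: xsE.
have -> : f x - phi f = f (x - lprestr (mem F) x) - phi (f - g).
  by rewrite dualB dualB phig opprB addrA subrK.
apply: le_trans (ler_normB _ _) _.
apply: (@le_trans _ _ (e / C * `|x| + `|phi| * (e / C))).
  apply: lerD; first exact: yF.
  apply: le_trans (dual_norm_le phi _) _; apply: ler_wpM2l fg; exact: dual_norm_ge0.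
by rewrite (mulrC `|phi|) -mulrDr mulrAC ler_pdivrMr// ler_pM2l// lerDl.
Qed.

End DualLpSum.

Section RealLine.
Context (R : realType).

Lemma id_linear : linear (id : R^o -> R^o).
Proof. by []. Qed.

Lemma id_bound (x : R^o) : `|x : R| <= 1 * `|x|.
Proof. by rewrite mul1r. Qed.

Definition id_dual : dual R^o := bounded_dual id_linear id_bound.

Lemma dual_realE (f : dual R^o) : f = f 1 *: id_dual.
Proof.
by apply: dual_eq => x; rewrite dualZ_coord /= -[X in f X]mulr1 [LHS]dualZ mulrC.
Qed.

Lemma real_reflexive : reflexive_space R^o.
Proof.
move=> phi; exists (phi id_dual); apply: dual_eq => f /=.
by rewrite [in RHS](dual_realE f) dualZ {1}(dual_realE f) dualZ_coord.
Qed.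

Lemma real_norming : norming R^o 1.
Proof.
move=> x; exists (Num.sg (x : R) *: id_dual).
  apply: dual_norm_le_bound => // y; rewrite dualZ_coord /= normrM mul1r.
  by rewrite ler_piMl// normr_sg; case: (_ != _).
by rewrite dualZ_coord /= mul1r normrEsg.
Qed.

End RealLine.

Lemma lp_space_norming (R : realType) (p : R) (p1 : 1 <= p) (G : choiceType) :
  norming (lp_space p1 G) (1 / 4).
Proof. by apply: lpsum_norming => // g; exact: real_norming. Qed.

Lemma lp_space_reflexive (R : realType) (p : R) (p1 : 1 <= p) (G : choiceType) :
  1 < p -> reflexive_space (lp_space p1 G).
Proof.
move=> p_gt1; apply: (@lpsum_reflexive _ _ _ _ _ 1) => // g.
  exact: real_norming.
exact: real_reflexive.
Qed.

Theorem theorem5p12 (R : realType) (q : nat -> R)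
    (q1 : forall k, (0 < k)%N -> 1 <= q k) (qoo : q @ \oo --> +oo)
    (G : nat -> choiceType)
    (cardG : forall k, (0 < k)%N -> has_aleph k [set: G k]) :
  [/\ forall (p : R) (p1 : 1 <= p), gamma (Xspace p1 q1 G) = 2,
      octahedral (Xspace (lexx 1) q1 G) /\ gamma (Xspace (lexx 1) q1 G) = 2
    & forall (p : R) (p1 : 1 <= p), 1 < p ->
      (forall k, (0 < k)%N -> 1 < q k) ->
      reflexive_space (Xspace p1 q1 G) /\ gamma (Xspace p1 q1 G) = 2].
Proof.
have gammaX (p : R) (p1 : 1 <= p) : gamma (Xspace p1 q1 G) = 2 by exact: gamma_Xspace.
split=> //.
  split=> //; apply: l1sum_octahedral => n.
  have [g _] := infinite_setN0 (has_aleph_infinite (cardG n.+1 isT)).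
  by exists (lpsingle (q1 n.+1 (ltn0Sn n)) g (1 : R^o)); rewrite lp_norm_single normr1.
move=> p p1 p_gt1 q_gt1; split=> //.
apply: (@lpsum_reflexive _ _ _ _ _ (1 / 4)) => // k; first exact: lp_space_norming.
by apply: lp_space_reflexive; exact: q_gt1.
Qed.
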